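(* For every $N\ge2$ the linear span of $\mathfrak B_N$ coincides with $V_{\mathrm{geo}}^N$, and $\dim(V^N_{\mathrm{geo}})=\mathrm{Card}(\mathfrak M_\Xi^N)$. Moreover, for every noise $\xi$ with exponent $\delta\in(0,1)$, the sets $\mathfrak B_\xi$ and $\mathfrak B_\xi^{\mathrm G}$ are generating sets for $V_{\mathrm{geo}}^\xi$ and $V_{\mathrm{geo}}^{\xi,\mathrm G}$, whose dimensions are respectively $$\sum_{i=2}^{N_\xi}\mathrm{Card}(\mathfrak M_\Xi^i)\qquad\text{and}\qquad\sum_{i=1}^{\lfloor N_\xi/2\rfloor}\mathrm{Card}(\mathfrak M_\Xi^{2i}).$$
   Context: Let $x_k,y_k$ ($k\in\mathbb N=\{0,1,\dots\}$) be commuting variables. For a monomial $m=\prod_kx_k^{a_k}\prod_ky_k^{b_k}$ put $((m))=\sum_ka_k$, $[m]=\sum_k(1-k)a_k-\sum_k(1+k)b_k$. Let $\mathfrak M=\{m:[m]=1,\ ((m))\ge2\}$, $\mathfrak M^N=\{m\in\mathfrak M:((m))=N\}$, and let $\mathcal M$, $\mathcal M^N$ be their real linear spans. Let $\mathfrak M_\Xi^N$ be the set of $m\in\mathfrak M^N$ involving only the variables $x_k$. For smooth $\Gamma,\sigma:\mathbb R\to\mathbb R$, $\Upsilon_{\Gamma,\sigma}:\mathcal M\to\mathcal C^\infty(\mathbb R,\mathbb R)$ is the linear map with $\Upsilon_{\Gamma,\sigma}(m)(u)=\prod_k(\sigma^{(k)}(u))^{a_k}\prod_k(2\Gamma^{(k)}(u))^{b_k}$.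 For a diffeomorphism $\varphi:\mathbb R\to\mathbb R$ and smooth $f,\Gamma$, define $\varphi\cdot f$ by $(\varphi\cdot f)(\varphi(u))=\varphi'(u)f(u)$ (applied to $f=\sigma$ and to $f=\Upsilon_{\Gamma,\sigma}(v)$), and define $\varphi\cdot\Gamma$ by $(\varphi\cdot\Gamma)(\varphi(u))(\varphi'(u))^2=\varphi'(u)\Gamma(u)-\varphi''(u)$. $V_{\mathrm{geo}}\subset\mathcal M$ is the subspace of all $v$ such that $\varphi\cdot\Upsilon_{\Gamma,\sigma}(v)=\Upsilon_{\varphi\cdot\Gamma,\varphi\cdot\sigma}(v)$ for all smooth $\Gamma,\sigma$ and all diffeomorphisms $\varphi$ of $\mathbb R$ homotopic to the identity. $V^N_{\mathrm{geo}}=V_{\mathrm{geo}}\cap\mathcal M^N$. On $\mathbb R[x_k,y_k:k\ge0]$ let $D$ be the derivation with $Dx_k=x_{k+1}$, $Dy_k=y_{k+1}$, and $\nabla_vw=v\,Dw+\frac12y_0vw$. Set $\mathfrak B_1=\{x_0\}$ and $\mathfrak B_{N+1}=\{\nabla_vw:v\in\mathfrak B_k,\ w\in\mathfrak B_{N+1-k},\ 1\le k\le N\}$ for $N\ge1$. The noise $\xi$ (an admissible, spatially symmetric random distribution with trajectories in $\mathcal C^{-2+\delta}$) enters only through its exponent $\delta\in(0,1)$: for a monomial $m$ in the variables $x_k,y_k$ put $|m|=\sum_k(-2+\delta+2k)a_k+\sum_k(2k+2)b_k$, and let $N_\xi$ be the largest integer such that $|m|<0$ for all $m\in\bigcup_{i=2}^{N_\xi}\mathfrak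 M^i$. Then $$\mathfrak B_\xi=\bigcup_{i=2}^{N_\xi}\mathfrak B_i,\quad \mathfrak B_\xi^{\mathrm G}=\bigcup_{i=1}^{\lfloor N_\xi/2\rfloor}\mathfrak B_{2i},\quad V^\xi_{\mathrm{geo}}=\bigoplus_{i=2}^{N_\xi}V^i_{\mathrm{geo}},\quad V^{\xi,\mathrm G}_{\mathrm{geo}}=\bigoplus_{i=1}^{\lfloor N_\xi/2\rfloor}V^{2i}_{\mathrm{geo}}$$ (the objects with superscript $\mathrm G$ are used in the paper when $\xi$ is Gaussian). *)

(* Defs.v *)
From HB Require Import structures.
From mathcomp Require Import all_boot all_order all_algebra.
From mathcomp Require Import finmap.
From mathcomp Require Import all_classical all_reals all_analysis.
(* the notations of monalg clash with those of mathcomp-analysis *)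
From mathcomp Require Import -(notations) monalg.
From mathcomp Require Import ring lra zify.

Set Implicit Arguments.
Unset Strict Implicit.
Unset Printing Implicit Defensive.

Import Order.TTheory GRing.Theory Num.Theory.
Import numFieldNormedType.Exports.
Local Open Scope ring_scope.
Local Open Scope classical_set_scope.

Section LinearAlgebra.
Context {R : realType} {V : lmodType R}.

Definition lspan (S : set V) : set V :=
  [set v | exists (n : nat) (c : 'I_n -> R) (w : 'I_n -> V),
     (forall i, S (w i)) /\ v = \sum_(i < n) c i *: w i].

Definition lin_indep (n : nat) (e : 'I_n -> V) :=
  forall c : 'I_n -> R, \sum_(i < n) c i *: e i = 0 -> forall i, c i = 0.

Definition has_dim (W : set V) (n : nat) :=
  exists e : 'I_n -> V, lin_indep e /\ lspan (range e) = W.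

Definition sum_spaces (r : seq nat) (W : nat -> set V) : set V :=
  [set v | exists w : nat -> V,
     (forall i, i \in r -> W i (w i)) /\ v = \sum_(i <- r) w i].

End LinearAlgebra.

(* [inl k] stands for the variable x_k and [inr k] for y_k *)
Definition var : choiceType := (nat + nat)%type.

(* The decidable equality and choice operator of [cmonom] are not reused: with
   the classical ones, unification no longer unfolds them when it compares
   products in [malg mon R], which takes very long. *)
Definition mon : Type := cmonom var.
HB.instance Definition _ := gen_eqMixin mon.
HB.instance Definition _ := gen_choiceMixin mon.
HB.instance Definition _ := Choice_isMonomialDef.Build mon
  (@mulcmA var) (@mul0cm var) (@mulcm0 var) (@mulcm_eq0 var).
HB.instance Definition _ := MonomialDef_isConomialDef.Build mon (@mulcmC var).

Definition mvar (i : var) : mon := ucm i.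

Lemma monP (m1 m2 : mon) : (forall i, m1 i = m2 i) -> m1 = m2.
Proof. by move=> e; apply: (elimT eqP (introT (@cmP var m1 m2) e)). Qed.

Lemma monM_E (m1 m2 : mon) i : mmul m1 m2 i = (m1 i + m2 i)%N.
Proof. exact: mulcmE. Qed.

Lemma mon1_E i : (mone : mon) i = 0%N.
Proof. exact: onecmE. Qed.

Lemma finsuppM (m1 m2 : mon) :
  finsupp (mmul m1 m2) = (finsupp m1 `|` finsupp m2)%fset.
Proof. exact: (@mdomD var). Qed.


Definition weight (V : nmodType) (w : var -> V) (m : mon) : V :=
  \sum_(i <- finsupp m) w i *+ m i.

Section Weights.
Context {V : nmodType} (w : var -> V).

Lemma weightEw (d : {fset var}) (m : mon) : (finsupp m `<=` d)%fset ->
  weight w m = \sum_(i <- d) w i *+ m i.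
Proof.
move=> le; apply: big_fset_incl => // i _; rewrite -cmE_eq0 => /eqP ->.
by rewrite mulr0n.
Qed.

Lemma weightM (m1 m2 : mon) : weight w (mmul m1 m2) = weight w m1 + weight w m2.
Proof.
rewrite (weightEw (d := finsupp (mmul m1 m2))) //.
have le1 : (finsupp m1 `<=` finsupp (mmul m1 m2))%fset by rewrite finsuppM fsubsetUl.
have le2 : (finsupp m2 `<=` finsupp (mmul m1 m2))%fset by rewrite finsuppM fsubsetUr.
rewrite (weightEw le1) (weightEw le2) -big_split /=; apply: eq_bigr => i _.
by rewrite monM_E mulrnDr.
Qed.

Lemma weightU i : weight w (mvar i) = w i.
Proof. by rewrite /weight mdomU big_seq_fset1 cmUU. Qed.
End Weights.

(* ((m)) *)
Definition noise_deg : mon -> nat :=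
  weight (fun i => if i is inl _ then 1%N else 0%N).

(* [m] *)
Definition scaling : mon -> int :=
  weight (fun i => match i with inl k => 1 - k%:Z | inr k => - (1 + k%:Z) end).

(* |m| *)
Definition homogeneity (R : realType) (delta : R) : mon -> R :=
  weight (fun i => match i with
                   | inl k => - 2 + delta + 2 * k%:R
                   | inr k => 2 * k%:R + 2
                   end).

Definition monM : set mon := [set m | scaling m = 1 /\ (2 <= noise_deg m)%N].
Definition monMN (N : nat) : set mon := [set m | monM m /\ noise_deg m = N].
Definition monXi (N : nat) : set mon :=
  [set m | monMN N m /\ forall k, m (inr k) = 0%N].

Lemma monXi_bound N m k : monXi N m ->
  (m (inl k) <= N)%N /\ (m (inl k) != 0%N -> (k < N)%N).
Proof.
move=> [[[s _] d] y0].
have [km|] := boolP (inl k \in finsupp m); last first.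
  by rewrite -cmE_eq0 => /eqP ->.
have mk0 : m (inl k) != 0%N by rewrite cmE_neq0.
have le : (m (inl k) <= N)%N.
  rewrite -d /noise_deg /weight (big_fsetD1 _ km) /=.
  by rewrite [1%N *+ _]natn leq_addr.
split=> // _.
have : (N%:Z - 1 =
    (\sum_(i <- finsupp m) if i is inl k then k * m i else 0)%N%:Z)%R.
  rewrite -s -d /scaling /noise_deg /weight !(big_morph Posz PoszD (erefl _)).
  rewrite -sumrB; apply: eq_bigr => -[j|j] _.
    rewrite [1%N *+ _]natn PoszM -[_ *+ m _]mulr_natr natz; ring.
  by rewrite y0 !mulr0n.
rewrite (big_fsetD1 _ km) /=; have : (k <= k * m (inl k))%N.
  by rewrite leq_pmulr // lt0n.
rewrite PoszD; set u := (k * _)%N; set t := bigop.body _ _ _.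
by move=> ku e; clear -ku e; lia.
Qed.

Lemma finite_monXi N : finite_set (monXi N).
Proof.
pose g (f : {ffun 'I_N -> 'I_N.+1}) : mon :=
  \big[@mmul mon/(mone : mon)]_(k < N)
    iter (f k) (mmul (mvar (inl (k : nat)))) (mone : mon).
have itE n i (j : var) : iter n (mmul (mvar j)) (mone : mon) i = (n * (j == i))%N.
  elim: n => [|n IH] /=; first by rewrite mon1_E.
  by rewrite monM_E cmU IH mulSn.
have gE f i : g f i = (\sum_(k < N) f k * ((inl (k : nat) : var) == i))%N.
  rewrite /g (big_morph (fun m : mon => m i) (id1 := 0%N) (op1 := addn)) => [|m1 m2|].
  - by apply: eq_bigr => k _; rewrite itE.
  - by rewrite monM_E.
  - by rewrite mon1_E.
apply: (@sub_finite_set _ _ (range g)); last exact: finite_image.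
move=> m mN; exists [ffun k : 'I_N => inord (m (inl (k : nat)))] => //.
apply: monP => i; rewrite gE; case: i => [k|k]; last first.
  by rewrite big1 => [|j _]; [case: mN => _ -> | rewrite muln0].
have [le lt] := monXi_bound k mN.
have [m0|mn0] := eqVneq (m (inl k)) 0%N.
  rewrite m0 big1 // => j _; rewrite ffunE; case: eqP => [[->]|]; last by rewrite muln0.
  by rewrite m0 inordK.
rewrite (bigD1 (Ordinal (lt mn0))) //= eqxx muln1 ffunE inordK // big1 ?addn0 // => j jk.
case: eqP => [[E]|]; last by rewrite muln0.
by move: jk; rewrite -val_eqE /= E eqxx.
Qed.

Definition cardXi (N : nat) : nat := #|` fset_set (monXi N)|%fset.

Notation pol R := (malg mon R).

Section Polynomials.
Variable R : realType.
Local Notation pol := (pol R).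

Definition pmon (m : mon) : pol := mkmalgU m 1.
Definition vx (k : nat) : pol := pmon (mvar (inl k)).
Definition vy (k : nat) : pol := pmon (mvar (inr k)).

Definition calM : set pol := lspan (pmon @` monM).
Definition calMN (N : nat) : set pol := lspan (pmon @` monMN N).

Definition succ_var (i : var) : var :=
  match i with inl k => inl k.+1 | inr k => inr k.+1 end.

Definition Dmon (m : mon) : pol :=
  \sum_(i <- finsupp m)
     (m i)%:R *: pmon (mmul (divcm m (mvar i)) (mvar (succ_var i))).

Definition Dpol (p : pol) : pol := \sum_(m <- msupp p) mcoeff m p *: Dmon m.

Definition nabla (v w : pol) : pol := v * Dpol w + 2^-1 *: (vy 0 * v * w).

Inductive calB : nat -> set pol :=
| calB_1 : calB 1 (vx 0)
| calB_S N k v w : (1 <= k <= N)%N -> calB k v -> calB (N.+1 - k) w ->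
    calB N.+1 (nabla v w).

End Polynomials.

Arguments calM : clear implicits.
Arguments calMN : clear implicits.
Arguments calB : clear implicits.

Section Derivation.
Variable R : realType.
Local Notation pol := (pol R).

Lemma DmonEw (d : {fset var}) (m : mon) : (finsupp m `<=` d)%fset ->
  Dmon R m = \sum_(i <- d)
     (m i)%:R *: pmon R (mmul (divcm m (mvar i)) (mvar (succ_var i))).
Proof.
move=> le; apply: big_fset_incl => // i _; rewrite -cmE_eq0 => /eqP ->.
by rewrite scale0r.
Qed.

Lemma pmonM m1 m2 : pmon R (mmul m1 m2) = pmon R m1 * pmon R m2.
Proof. by rewrite [RHS]malgM_def fgmulUU mulr1. Qed.

Lemma polE (p : pol) : p = \sum_(m <- msupp p) mcoeff m p *: pmon R m.
Proof.
rewrite [LHS]monalgE; apply: eq_bigr => m _; apply/malgP => m'.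
rewrite /pmon mcoeffU. rewrite mcoeffZ. rewrite mcoeffU. by rewrite mulrnAr mulr1.
Qed.

Let scale_nat0 n (p q : pol) : n = 0%N -> n%:R *: p = n%:R *: q.
Proof. by move=> ->; rewrite !scale0r. Qed.

Lemma DmonM m1 m2 :
  Dmon R (mmul m1 m2) = Dmon R m1 * pmon R m2 + pmon R m1 * Dmon R m2.
Proof.
set d := finsupp (mmul m1 m2).
have le1 : (finsupp m1 `<=` d)%fset by rewrite /d finsuppM fsubsetUl.
have le2 : (finsupp m2 `<=` d)%fset by rewrite /d finsuppM fsubsetUr.
rewrite (@DmonEw d) // (DmonEw le1) (DmonEw le2) mulr_suml mulr_sumr -big_split /=.
apply: eq_bigr => i _.
rewrite monM_E natrD scalerDl; congr (_ + _).
  rewrite -scalerAl -pmonM.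
  have [E0|m0] := eqVneq (m1 i) 0%N; first exact: scale_nat0.
  congr (_ *: pmon _ _); apply: monP => j.
  rewrite !monM_E !divcmE !monM_E !cmU.
  case: eqP => [<-|_] /=; last by lia.
  by rewrite -addnBAC ?lt0n //= addnAC.
rewrite -scalerAr -pmonM.
have [E0|m0] := eqVneq (m2 i) 0%N; first exact: scale_nat0.
congr (_ *: pmon _ _); apply: monP => j.
rewrite !monM_E !divcmE !monM_E !cmU.
case: eqP => [<-|_] /=; last by lia.
by rewrite -addnBA ?lt0n //= addnA.
Qed.

Lemma DpolE (p : pol) : Dpol p = mmap (@mkmalgU mon R (mone : mon)) (Dmon R) p.
Proof. by apply: eq_bigr => m _; rewrite mul_malgC. Qed.

Lemma Dpol_pmon m : Dpol (pmon R m) = Dmon R m.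
Proof. by rewrite DpolE mmapU mul_malgC scale1r. Qed.

Lemma DpolD : {morph @Dpol R : p q / p + q}.
Proof. by move=> p q; rewrite !DpolE raddfD. Qed.

Lemma DpolZ c (p : pol) : Dpol (c *: p) = c *: Dpol p.
Proof.
rewrite DpolE (mmapEw (msuppZ_le _ _)) scaler_sumr; apply: eq_bigr => m _.
by rewrite mul_malgC mcoeffZ scalerA.
Qed.

Lemma Dpol_sum (I : Type) (r : seq I) (F : I -> pol) :
  Dpol (\sum_(i <- r) F i) = \sum_(i <- r) Dpol (F i).
Proof.
apply: (big_morph _ DpolD); by rewrite DpolE raddf0.
Qed.

Lemma Dpol_vx k : Dpol (vx R k) = vx R k.+1.
Proof.
rewrite Dpol_pmon /Dmon mdomU big_seq_fset1 cmUU scale1r; congr pmon.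
by apply: monP => j; rewrite monM_E divcmE subnn.
Qed.

Lemma Dpol_vy k : Dpol (vy R k) = vy R k.+1.
Proof.
rewrite Dpol_pmon /Dmon mdomU big_seq_fset1 cmUU scale1r; congr pmon.
by apply: monP => j; rewrite monM_E divcmE subnn.
Qed.

Lemma Dpol_mul (p q : pol) : Dpol (p * q) = Dpol p * q + p * Dpol q.
Proof.
have ind (P : pol -> Prop) : (forall c m, P (c *: pmon R m)) ->
    (forall a b, P a -> P b -> P (a + b)) -> P 0 -> forall a, P a.
  move=> PZ PD P0 a; rewrite (polE a).
  by apply: big_ind => // m _; exact: PZ.
move: p; apply: (ind) => [c m|a b ha hb|]; last 2 first.
- by rewrite mulrDl !DpolD ha hb !mulrDl addrACA.
- have D0 : Dpol (0 : pol) = 0 by rewrite DpolE raddf0.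
  by rewrite !mul0r D0 mul0r addr0.
move: q; apply: ind => [d n|a b ha hb|]; last 2 first.
- by rewrite mulrDr !DpolD ha hb !mulrDr addrACA.
- have D0 : Dpol (0 : pol) = 0 by rewrite DpolE raddf0.
  by rewrite !mulr0 D0 mulr0 addr0.
rewrite -scalerAl -scalerAr -pmonM !DpolZ !Dpol_pmon DmonM.
move: (Dmon R m) (Dmon R n) (pmon R m) (pmon R n) => x y z t.
by rewrite -!scalerAl -!scalerAr !scalerDr.
Qed.
End Derivation.

Definition smooth (R : realType) (f : R -> R) :=
  forall n x, derivable f^`(n) x 1.

(* Every continuous self-map of R satisfies [homotopic R idfun]; the condition
   is kept in [Vgeo] because it is part of the definition. *)
Definition homotopic (R : realType) (S T : topologicalType) (f g : S -> T) :=
  exists H : R * S -> T,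
    [/\ {within `[0, 1] `*` [set: S], continuous H},
        forall x, H (0, x) = f x & forall x, H (1, x) = g x].

Record diffeo (R : realType) := Diffeo {
  dfun :> R -> R;
  dinv : R -> R;
  dfun_smooth : smooth dfun;
  dinv_smooth : smooth dinv;
  dfunK : cancel dfun dinv;
  dinvK : cancel dinv dfun }.

Arguments dfun_smooth {R} d n x.
Arguments dinv_smooth {R} d n x.

Section Geometric.
Variable R : realType.
Implicit Types (Gamma sigma f : R -> R) (phi : diffeo R).

Definition Upsilon_mon Gamma sigma (m : mon) (u : R) : R :=
  \prod_(i <- finsupp m)
     match i with inl k => sigma^`(k)%classic u | inr k => 2 * Gamma^`(k)%classic u end ^+ m i.

Definition Upsilon Gamma sigma (v : pol R) (u : R) : R :=
  \sum_(m <- msupp v) mcoeff m v * Upsilon_mon Gamma sigma m u.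

Definition act_vf phi f : R -> R :=
  fun y => let u := dinv phi y in phi^`()%classic u * f u.

Definition act_Gamma phi Gamma : R -> R :=
  fun y => let u := dinv phi y in
    (phi^`()%classic u * Gamma u - phi^`(2)%classic u) / phi^`()%classic u ^+ 2.

Lemma diffeo_derive_neq0 phi u : phi^`()%classic u != 0.
Proof.
have H : (dinv phi \o phi)^`()%classic u = 1.
  have -> : dinv phi \o phi = id by apply/funext => x /=; rewrite dfunK.
  by rewrite derive1E derive_id.
apply/eqP => E0; move: H; rewrite derive1_comp.
- by rewrite E0 mulr0 => /esym/eqP; rewrite oner_eq0.
- exact: (dfun_smooth phi 0%N u).
- exact: (dinv_smooth phi 0%N (phi u)).
Qed.

Lemma act_vfE phi f u : act_vf phi f (phi u) = phi^`()%classic u * f u.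
Proof. by rewrite /act_vf dfunK. Qed.

Lemma act_GammaE phi Gamma u :
  act_Gamma phi Gamma (phi u) * phi^`()%classic u ^+ 2 =
  phi^`()%classic u * Gamma u - phi^`(2)%classic u.
Proof. by rewrite /act_Gamma dfunK divfK // expf_neq0 // diffeo_derive_neq0. Qed.

Definition Vgeo : set (pol R) :=
  [set v | calM R v /\
     forall Gamma sigma, smooth Gamma -> smooth sigma ->
     forall phi, homotopic R idfun phi ->
       act_vf phi (Upsilon Gamma sigma v) =
       Upsilon (act_Gamma phi Gamma) (act_vf phi sigma) v].

Definition VgeoN (N : nat) : set (pol R) := Vgeo `&` calMN R N.

End Geometric.

Arguments Vgeo : clear implicits.
Arguments VgeoN : clear implicits.

Lemma calMN_mcoeff (R : realType) N (v : pol R) m :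
  calMN R N v -> noise_deg m != N -> mcoeff m v = 0.
Proof.
move=> [n [c [w [wS ->]]]] mN; rewrite raddf_sum big1 // => i _.
have [m' [_ mN'] <-] := wS i.
rewrite /= mcoeffZ mcoeffU; case: eqP => [E|]; last by rewrite mulr0.
by rewrite -E mN' eqxx in mN.
Qed.

Lemma sum_VgeoN_direct (R : realType) (r : seq nat) (w : nat -> pol R) : uniq r ->
  (forall i, i \in r -> VgeoN R i (w i)) -> \sum_(i <- r) w i = 0 ->
  forall i, i \in r -> w i = 0.
Proof.
move=> ur wV s0 i ir; apply/malgP => m; rewrite mcoeff0.
have [dm|] := eqVneq (noise_deg m) i; last exact: calMN_mcoeff (wV i ir).2.
have := congr1 (mcoeff m) s0; rewrite mcoeff0 raddf_sum (bigD1_seq i) //=.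
rewrite big_seq_cond big1 ?addr0 // => j /andP[jr ji].
by apply: calMN_mcoeff (wV j jr).2 _; rewrite dm eq_sym.
Qed.

Section Noise.
Variable R : realType.

Definition negative_upto (delta : R) (n : nat) :=
  forall i m, (2 <= i <= n)%N -> monMN i m -> homogeneity delta m < 0.

Definition is_Nxi (delta : R) (n : nat) :=
  negative_upto delta n /\ forall n', negative_upto delta n' -> (n' <= n)%N.

(* the junk value 0 is not taken for 0 < delta < 1, see [NxiP] *)
Definition Nxi (delta : R) : nat := xget 0%N (is_Nxi delta).

End Noise.

Lemma homogeneityE (R : realType) (delta : R) m :
  homogeneity delta m = delta * (noise_deg m)%:R - 2 * (scaling m)%:~R.
Proof.
rewrite /homogeneity /noise_deg /scaling /weight natr_sum rmorph_sum /=.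
rewrite !mulr_sumr -sumrB; apply: eq_bigr => i _.
have E (z : int) (n : nat) : (z *+ n)%:~R = z%:~R * n%:R :> R.
  by rewrite rmorphMn /= mulr_natr.
rewrite E -[_ *+ m i]mulr_natr mulr_natr -mulr_natr.
case: i => k /=; rewrite ?mulr0n ?mulr1n ?rmorphB ?rmorphN ?rmorphD /=.
  have -> : (1%N *+ m (inl k))%:R = (m (inl k))%:R :> R by congr (_ %:R); exact: (natn (m (inl k))).
  ring.
have -> : (0%N *+ m (inr k)) = 0%N by rewrite mul0rn.
ring.
Qed.

Lemma monMN_neq0 i : (2 <= i)%N -> monMN i !=set0.
Proof.
move=> i2; pose u j := iter j (mmul (mvar (inl 1%N))) (mvar (inl 0%N)).
have un j : noise_deg (u j) = j.+1.
  elim: j => [|j IH]; first by rewrite /noise_deg weightU.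
  by rewrite /noise_deg /= weightM weightU [weight _ _]IH.
have us j : scaling (u j) = 1.
  elim: j => [|j IH]; first by rewrite /scaling weightU.
  by rewrite /scaling /= weightM weightU [weight _ (u j)]IH.
exists (u i.-1); rewrite /monMN /monM /=; rewrite un us; split; [split|] => //; lia.
Qed.

Lemma negative_uptoP (R : realType) (delta : R) n : (2 <= n)%N -> 0 < delta ->
  negative_upto delta n <-> delta * n%:R < 2.
Proof.
move=> n2 d0; split=> [H|H i m /andP[i2 ilen] [[s _] d]].
  have [m mi] := monMN_neq0 n2.
  have := H n m; rewrite n2 leqnn => /(_ isT mi).
  by case: mi => -[s _] d; rewrite homogeneityE s d mulr1 subr_lt0.
rewrite homogeneityE s d mulr1 subr_lt0; apply: le_lt_trans H.
by rewrite ler_pM2l // ler_nat.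
Qed.

Lemma NxiP (R : realType) (delta : R) : 0 < delta < 1 -> is_Nxi delta (Nxi delta).
Proof.
move=> /andP[d0 d1]; apply: xgetPex.
pose P n := `[< negative_upto delta n >].
have P2 : P 2%N by apply/asboolP; apply/(@negative_uptoP R delta 2 isT d0); lra.
have bP n : P n -> (n <= (Num.truncn (2 / delta)).+1)%N.
  move=> /asboolP; case: (leqP 2 n) => [n2|]; last by lia.
  move=> /(negative_uptoP n2 d0) lt; apply: ltnW.
  rewrite -(ltr_nat R); apply: lt_trans (truncnS_gt _).
  by rewrite ltr_pdivlMr // mulrC.
have exP : exists n, P n by exists 2%N.
have [n /asboolP Pn maxn] := ex_maxnP exP bP.
by exists n; split=> // n' Hn'; apply: maxn; apply/asboolP.
Qed.

Section NoiseSpaces.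
Variable R : realType.

Definition calBxi (delta : R) : set (pol R) :=
  \bigcup_(i in [set i | (2 <= i <= Nxi delta)%N]) calB R i.
Definition calBxiG (delta : R) : set (pol R) :=
  \bigcup_(i in [set i | (1 <= i <= (Nxi delta)./2)%N]) calB R (2 * i).

(* [sum_VgeoN_direct] shows that these sums are direct *)
Definition Vxi (delta : R) : set (pol R) :=
  sum_spaces (index_iota 2 (Nxi delta).+1) (VgeoN R).
Definition VxiG (delta : R) : set (pol R) :=
  sum_spaces (index_iota 1 (Nxi delta)./2.+1) (fun i => VgeoN R (2 * i)).

End NoiseSpaces.

(* Main.v *)
Require Import Defs.
From mathcomp Require Import all_boot all_order all_algebra.
From mathcomp Require Import finmap.
From mathcomp Require Import all_classical all_reals all_analysis.
From mathcomp Require Import -(notations) monalg.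
From mathcomp Require Import ring lra zify.

(** Write [pi v] for the part of a polynomial [v] that involves only the
    variables x_k. Everything follows from three facts about [pi].

    - Elements of [calB N] are geometric ([calB_covariant]): [Upsilon] sends y_0
      to [2 Gamma], hence [nabla v w] to the covariant derivative
      [v w' + Gamma v w], and the law by which a diffeomorphism acts on [Gamma]
      is exactly the one that makes this expression a vector field again.

    - [pi] is injective on geometric elements ([Vgeo_xonly_eq0]). On the line
      every connection is flat: if [phi'' = phi' Gamma] then [phi] carries
      [Gamma] to [0]. If [pi v = 0], then [Upsilon] sends [v] to [0] when the
      connection is [0], hence by covariance also for this [Gamma] and every
      [sigma]. The jets of [Gamma] and [sigma] at a point can be prescribed
      ([flat_connection_with_jet], [poly_with_jet]), so [v] vanishes at every
      point of the affine space of jets, and [v = 0] ([ev_eq0]).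

    - Every monomial in the x_k of noise degree [N] and scaling [1] is [pi p]
      for some [p] in the span of [calB N] ([hits_monomial]). Modulo the y_k,
      [nabla v w] is the Novikov product [v D w], and if x_k occurs in [m] with
      [k >= 1], then [m = v x_0^(k-1) x_k] for some monomial [v] of scaling
      [1], and

        [m = v D(x_0^(k-1) x_(k-1)) - (k-1) (v x_0^(k-2) x_(k-1)) D x_0]

      reduces [m] to monomials of smaller noise degree.

    Hence the coefficients of the monomials of [monXi N] are linear coordinates
    on [VgeoN N] for which the span of [calB N] contains a dual basis; by
    [basis_of_dual_forms] this span is the whole space, of dimension [cardXi N].
    The assertions about a noise follow because [VgeoN N] for distinct [N] are
    independent, being distinguished by the noise degree. *)

Import Order.TTheory GRing.Theory Num.Theory.
Import numFieldNormedType.Exports.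
Local Open Scope ring_scope.
Local Open Scope classical_set_scope.
Set Implicit Arguments.
Unset Strict Implicit.
Unset Printing Implicit Defensive.

(** * Smooth functions and diffeomorphisms of the line *)
Section Smooth.
Variable R : realType.
Implicit Types (f g : R -> R) (x : R).

Lemma derive1_eq f (x l : R) : is_derive x 1 f l -> f^`()%classic x = l.
Proof. by move=> h; rewrite derive1E; exact: derive_val. Qed.

(** The derivative of a product or of a composition is again built from the
    functions and their derivatives, so closure properties of smoothness are
    proved by induction on the order of differentiability, simultaneously for
    all functions. *)
Fixpoint Cn n f : Prop :=
  if n is n'.+1 then (forall x, derivable f x 1) /\ Cn n' f^`()%classic else True.

Lemma smoothP f : smooth f <-> forall n, Cn n f.
Proof.
split=> [sf n|Cf n x].
  elim: n f sf => //= n IH f sf; split=> [x|]; first exact: (sf 0%N x).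
  by apply: IH => k x; rewrite -derive1Sn.
elim: n f Cf x => [|n IH] f Cf x; first by have [] := Cf 1%N.
by rewrite derive1Sn; apply: IH => k; have [] := Cf k.+1.
Qed.

Lemma CnS n f : Cn n.+1 f -> Cn n f.
Proof. by elim: n f => // n IH f [df Cf]; split=> //; apply: IH. Qed.

Lemma smooth_derivable f x : smooth f -> derivable f x 1.
Proof. by move=> /(_ 0%N x). Qed.

Lemma smooth_continuous f : smooth f -> continuous f.
Proof.
by move=> sf x; apply/differentiable_continuous/derivable1_diffP/smooth_derivable.
Qed.

Lemma smooth_is_derive f x : smooth f -> is_derive x 1 f (f^`()%classic x).
Proof. by move=> sf; rewrite derive1E; apply/derivableP/smooth_derivable. Qed.

Lemma smooth_derive1 f : smooth f -> smooth f^`()%classic.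
Proof. by move=> sf n x; rewrite -derive1Sn; exact: sf. Qed.

Lemma smooth_derive1n n f : smooth f -> smooth f^`(n).
Proof. by move=> sf; elim: n => [|n IH]; [exact: sf | exact: smooth_derive1 IH]. Qed.

Lemma CnD n f g : Cn n f -> Cn n g -> Cn n (fun x => f x + g x).
Proof.
elim: n f g => //= n IH f g [df Cf] [dg Cg]; split=> [x|].
  exact: derivableD.
have -> : (fun x => f x + g x)^`()%classic = fun x => f^`()%classic x + g^`()%classic x.
  apply/funext => x; apply: derive1_eq; rewrite !derive1E.
  by apply: is_deriveD; apply/derivableP.
exact: IH.
Qed.

Lemma derive1M f g x : derivable f x 1 -> derivable g x 1 ->
  (fun x => f x * g x)^`()%classic x = f^`()%classic x * g x + f x * g^`()%classic x.
Proof.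
move=> df dg; rewrite !derive1E (deriveM df dg) addrC [g x *: _]mulrC.
reflexivity.
Qed.

Lemma CnM n f g : Cn n f -> Cn n g -> Cn n (fun x => f x * g x).
Proof.
elim: n f g => //= n IH f g [df Cf] [dg Cg]; split=> [x|].
  exact: derivableM.
have -> : (fun x => f x * g x)^`()%classic = fun x => f^`()%classic x * g x + f x * g^`()%classic x.
  by apply/funext => x; rewrite derive1M.
by apply: CnD; apply: IH => //; apply: CnS.
Qed.

Lemma Cn_cst n (c : R) : Cn n (fun=> c).
Proof.
elim: n c => //= n IH c; split=> [x|]; first exact: derivable_cst.
by rewrite (_ : _^`()%classic = fun=> 0) //; apply/funext => x; exact: derive1_cst.
Qed.

Lemma derivable1_comp f g x : derivable f x 1 -> derivable g (f x) 1 ->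
  derivable (fun x => g (f x)) x 1.
Proof.
by move=> /derivable1_diffP df /derivable1_diffP dg;
  apply/derivable1_diffP; exact: differentiable_comp.
Qed.

Lemma derive1_compE f g x : derivable f x 1 -> derivable g (f x) 1 ->
  (fun x => g (f x))^`()%classic x = g^`()%classic (f x) * f^`()%classic x.
Proof. exact: derive1_comp. Qed.

Lemma Cn_comp n f g : Cn n f -> Cn n g -> Cn n (fun x => g (f x)).
Proof.
elim: n f g => //= n IH f g [df Cf] [dg Cg]; split=> [x|].
  exact: derivable1_comp.
have -> : (fun x => g (f x))^`()%classic = fun x => g^`()%classic (f x) * f^`()%classic x.
  by apply/funext => x; rewrite derive1_compE.
by apply: CnM => //; apply: IH => //; apply: CnS.
Qed.

Lemma derive1V f x : f x != 0 -> derivable f x 1 ->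
  (fun x => (f x)^-1)^`()%classic x = - f^`()%classic x * ((f x)^-1 * (f x)^-1).
Proof.
move=> f0 df; rewrite !derive1E (@deriveV _ _ f) // -exprVn expr2.
by rewrite scaleNr mulNr [_ *: _]mulrC.
Qed.

Lemma CnV n f : (forall x, f x != 0) -> Cn n f -> Cn n (fun x => (f x)^-1).
Proof.
move=> f0; elim: n => //= n IH [df Cf]; split=> [x|]; first exact: derivableV.
have -> : (fun x => (f x)^-1)^`()%classic =
    fun x => -1 * f^`()%classic x * ((f x)^-1 * (f x)^-1).
  by apply/funext => x; rewrite derive1V // mulN1r.
have CV : Cn n (fun x => (f x)^-1).
  by apply: IH; apply: CnS; split.
apply: CnM; first by apply: CnM => //; exact: Cn_cst.
exact: CnM.
Qed.

Lemma smoothD f g : smooth f -> smooth g -> smooth (fun x => f x + g x).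
Proof. by move=> /smoothP sf /smoothP sg; apply/smoothP => n; apply: CnD. Qed.

Lemma smooth_cst (c : R) : smooth (fun=> c).
Proof. by apply/smoothP => n; exact: Cn_cst. Qed.

Lemma smoothM f g : smooth f -> smooth g -> smooth (fun x => f x * g x).
Proof. by move=> /smoothP sf /smoothP sg; apply/smoothP => n; apply: CnM. Qed.

Lemma smooth_comp f g : smooth f -> smooth g -> smooth (fun x => g (f x)).
Proof. by move=> /smoothP sf /smoothP sg; apply/smoothP => n; apply: Cn_comp. Qed.

Lemma smoothV f : (forall x, f x != 0) -> smooth f -> smooth (fun x => (f x)^-1).
Proof. by move=> f0 /smoothP sf; apply/smoothP => n; apply: CnV. Qed.

Lemma derive1n_horner (p : {poly R}) n : (horner p)^`(n)%classic = horner p^`(n).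
Proof. by elim: n => // n IH; rewrite derive1nS IH -derivE derivnS. Qed.

Lemma smooth_horner (p : {poly R}) : smooth (horner p).
Proof. by move=> n x; rewrite derive1n_horner; exact: derivable_horner. Qed.

(** The inverse satisfies [g' = 1 / (f' o g)], so that [g] gains one order of
    differentiability from itself. *)
Lemma smooth_inverse f g : smooth f -> (forall x, f^`()%classic x != 0) ->
  cancel f g -> cancel g f -> smooth g.
Proof.
move=> sf f0 fK gK.
have dg (y : R) : is_derive y 1 g (f^`()%classic (g y))^-1.
  rewrite -{1}(gK y); apply: (@is_derive_inverse _ f) => //.
  - by apply: filterE => z; rewrite fK.
  - by apply: filterE => z; exact: smooth_continuous.
  - exact: smooth_is_derive.
have g'E : g^`()%classic = fun y => (f^`()%classic (g y))^-1.
  by apply/funext => y; exact: derive1_eq.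
have CV n : Cn n (fun x => (f^`()%classic x)^-1).
  by apply: CnV => //; apply: (proj1 (smoothP _)); exact: smooth_derive1.
apply/smoothP; elim=> //= n IH; split=> [y|]; first exact: ex_derive.
by rewrite g'E; apply: (Cn_comp IH (CV n)).
Qed.

(** Strict monotonicity and the intermediate value theorem give the inverse
    function, [smooth_inverse] its smoothness. *)
Lemma diffeo_of_derive_gt0 f : smooth f -> (forall x, 0 < f^`()%classic x) ->
  (forall y, exists a b, f a <= y <= f b) -> exists phi : diffeo R, dfun phi = f.
Proof.
move=> sf f'0 fy.
have fmono : {mono f : x y / x <= y}.
  apply: le_mono => x y xy.
  apply: (@gtr0_derive1_lt_cc _ f x y); rewrite ?in_itv /= ?lexx ?(ltW xy) //.
  - by move=> z _; exact: smooth_derivable.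
  - exact/continuous_subspaceT/smooth_continuous.
have fsurj y : exists x, f x = y.
  have [a [b /andP[ay yb]]] := fy y.
  have ab : a <= b by rewrite -fmono (le_trans ay).
  have [||c _ <-] := @IVT _ f a b y ab; last by exists c.
    exact/continuous_subspaceT/smooth_continuous.
  by rewrite min_l ?max_r ?fmono // ay.
pose g y := sval (cid (fsurj y)).
have gK : cancel g f by move=> y; rewrite /g; case: cid.
have fK : cancel f g by move=> x; apply: (inc_inj fmono); rewrite gK.
have sg : smooth g by apply: (smooth_inverse sf) => // x; rewrite gt_eqF.
by exists (Diffeo sf sg fK gK).
Qed.

Lemma homotopic_continuous f : continuous f -> homotopic R idfun f.
Proof.
move=> cf; exists (fun z : R * R => (1 - z.1) * z.2 + z.1 * f z.2); split=> /=.
- apply/continuous_subspaceT => z.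
  apply: cvgD.
    apply: cvgM; last exact: cvg_snd.
    by apply: cvgB; [exact: cvg_cst | exact: cvg_fst].
  apply: cvgM; first exact: cvg_fst.
  by apply: (@continuous_comp _ _ _ snd f); [exact: cvg_snd | exact: cf].
- by move=> x; rewrite subr0 mul1r mul0r addr0.
- by move=> x; rewrite subrr mul0r mul1r add0r.
Qed.

(** Functions that differ by a smooth multiple of [x ^+ K] have the same
    derivatives of order below [K] at 0. *)
Lemma derive1n_Xn_mul h K j : smooth h -> (j < K)%N ->
  (fun x => x ^+ K * h x)^`(j)%classic 0 = 0.
Proof.
elim: j K h => [|j IH] [//|K] h sh jK.
  by rewrite /= expr0n mul0r.
have sX n : smooth (fun x : R => x ^+ n).
  by have := @smooth_horner 'X^n; congr smooth; apply/funext => x; rewrite hornerXn.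
rewrite derive1Sn.
have -> : (fun x => x ^+ K.+1 * h x)^`()%classic =
    fun x => x ^+ K * (K.+1%:R * h x + x * h^`()%classic x).
  apply/funext => x; rewrite (derive1M (f := fun x => x ^+ K.+1)).
  - rewrite exp_derive1 (_ : _ *: _ = K.+1%:R * x ^+ K) //= exprS.
    by move: (derive1 h x) (h x) (x ^+ K) => a b c; ring.
  - exact: (@smooth_derivable _ x (sX K.+1)).
  - exact: smooth_derivable.
apply: IH => //; apply: smoothD; first exact: smoothM (smooth_cst (c := _)) sh.
exact: smoothM (sX 1%N) (smooth_derive1 sh).
Qed.

Lemma derive1nD f g n : smooth f -> smooth g ->
  (fun x => f x + g x)^`(n)%classic = fun x => f^`(n)%classic x + g^`(n)%classic x.
Proof.
move=> sf sg; elim: n => // n; rewrite !derive1nS => ->.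
apply/funext => x; apply: derive1_eq.
by apply: is_deriveD; apply: smooth_is_derive; exact: smooth_derive1n.
Qed.
End Smooth.

(** * Spans, dimensions and direct sums *)
Section Spans.
Variables (R : realType) (V : lmodType R).
Implicit Types (S W A B : set V) (u v : V).

Definition is_subspace W := W 0 /\ forall (c : R) u v, W u -> W v -> W (c *: u + v).

Lemma subspace0 W : is_subspace W -> W 0.
Proof. by case. Qed.

Lemma subspaceP W (c : R) u v : is_subspace W -> W u -> W v -> W (c *: u + v).
Proof. by move=> [_]; exact. Qed.

Arguments subspaceP {W} c {u v}.

Lemma subspaceD W u v : is_subspace W -> W u -> W v -> W (u + v).
Proof. by move=> [_ WZ] Wu Wv; rewrite -[u]scale1r; exact: WZ. Qed.

Lemma subspaceZ W c u : is_subspace W -> W u -> W (c *: u).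
Proof. by move=> [W0 WZ] Wu; rewrite -[_ *: _]addr0; exact: WZ. Qed.

Lemma subspaceN W u : is_subspace W -> W u -> W (- u).
Proof. by move=> sW Wu; rewrite -scaleN1r; exact: subspaceZ. Qed.

Lemma subspace_sum W (I : Type) (r : seq I) (P : pred I) (F : I -> V) :
  is_subspace W -> (forall i, P i -> W (F i)) -> W (\sum_(i <- r | P i) F i).
Proof.
move=> sW WF; apply: big_ind => //; first exact: sW.1.
by move=> u v; exact: subspaceD.
Qed.

Lemma lspan_incl S : S `<=` lspan S.
Proof.
move=> v Sv; exists 1%N, (fun=> 1), (fun=> v); split=> //.
by rewrite big_ord1 scale1r.
Qed.

Lemma lspan_min S W : is_subspace W -> S `<=` W -> lspan S `<=` W.
Proof.
move=> sW SW _ [n [c [w [Sw ->]]]]; apply: subspace_sum => // i _.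
by apply: subspaceZ => //; exact: SW.
Qed.

Lemma subspace_lspan S : is_subspace (lspan S).
Proof.
split; first by exists 0%N, (fun=> 0), (fun=> 0); split=> [[]//|]; rewrite big_ord0.
move=> c _ _ [n [a [u [Su ->]]]] [m [b [v [Sv ->]]]].
exists (n + m)%N, (fun i : 'I_(n + m) => match fintype.split i with inl j => c * a j | inr j => b j end),
  (fun i : 'I_(n + m) => match fintype.split i with inl j => u j | inr j => v j end).
split=> [i|]; first by case: (fintype.split i).
rewrite big_split_ord scaler_sumr /=; congr (_ + _); apply: eq_bigr => i _.
  by case: splitP => j /= E; [rewrite scalerA (ord_inj E) | have := ltn_ord i; lia].
by case: splitP => j /= E; [have := ltn_ord j; lia | rewrite (ord_inj (addnI E))].
Qed.

Lemma lspan_mono S A : S `<=` A -> lspan S `<=` lspan A.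
Proof.
by move=> SA; apply: lspan_min (subspace_lspan _) _ => v /SA; exact: lspan_incl.
Qed.

Lemma has_dim_subspace W n : has_dim W n -> is_subspace W.
Proof. by move=> [e [_ <-]]; exact: subspace_lspan. Qed.

Lemma lspan_rangeP n (e : 'I_n -> V) v :
  lspan (range e) v -> exists c : 'I_n -> R, v = \sum_(i < n) c i *: e i.
Proof.
apply: (lspan_min (W := [set v | exists c : 'I_n -> R, v = \sum_(i < n) c i *: e i])).
  split; first by exists (fun=> 0); rewrite big1 // => i _; rewrite scale0r.
  move=> c _ _ [a ->] [b ->]; exists (fun i => c * a i + b i).
  rewrite scaler_sumr -big_split; apply: eq_bigr => i _.
  by rewrite scalerA scalerDl.
move=> _ [i _ <-]; exists (fun j => (j == i)%:R).
rewrite (bigD1 i) //= eqxx scale1r big1 ?addr0 // => j /negPf ->.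
by rewrite scale0r.
Qed.

Lemma has_dim0 : has_dim [set (0 : V)] 0.
Proof.
exists (fun=> 0); split=> [c _ []//|]; apply/seteqP; split=> v.
  by move=> /lspan_rangeP[c ->]; rewrite big_ord0.
by move=> ->; exact: (subspace_lspan _).1.
Qed.

Lemma has_dimD A B n m : has_dim A n -> has_dim B m ->
  (forall v, A v -> B v -> v = 0) ->
  has_dim [set v | exists a b, [/\ A a, B b & v = a + b]] (n + m).
Proof.
move=> hA hB AB0; have sA := has_dim_subspace hA; have sB := has_dim_subspace hB.
case: hA hB => [eA [iA AE]] [eB [iB BE]].
pose e (i : 'I_(n + m)) := match fintype.split i with inl j => eA j | inr j => eB j end.
have el i : e (lshift m i) = eA i by rewrite /e (unsplitK (inl i)).
have er i : e (rshift n i) = eB i by rewrite /e (unsplitK (inr i)).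
have AeA i : A (eA i) by rewrite -AE; apply: lspan_incl; exists i.
have BeB i : B (eB i) by rewrite -BE; apply: lspan_incl; exists i.
exists e; split=> [c|].
  rewrite big_split_ord /=; under eq_bigr do rewrite el.
  under [X in _ + X]eq_bigr do rewrite er.
  set a := \sum_(i < n) _; set b := \sum_(i < m) _ => ab0.
  have Aa : A a by apply: subspace_sum => // i _; exact: subspaceZ.
  have Bb : B b by apply: subspace_sum => // i _; exact: subspaceZ.
  have aE : a = - b by apply/eqP; rewrite -addr_eq0 ab0.
  have a0 : a = 0 by apply: AB0 => //; rewrite aE; exact: subspaceN.
  have b0 : b = 0 by rewrite -[b]opprK -aE a0 oppr0.
  by move=> i; rewrite -(splitK i); case: (fintype.split i) => j /=; [exact: iA a0 j | exact: iB b0 j].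
apply/seteqP; split=> v.
  apply: lspan_min => [|_ [i _ <-]].
    split; first by exists 0, 0; rewrite addr0; split=> //; [exact: sA.1 | exact: sB.1].
    move=> c _ _ [a [b [Aa Bb ->]]] [a' [b' [Aa' Bb' ->]]].
    exists (c *: a + a'), (c *: b + b'); split; [exact: sA.2|exact: sB.2|].
    by rewrite scalerDr addrACA.
  rewrite /e; case: (fintype.split i) => j.
    by exists (eA j), 0; rewrite addr0; split=> //; exact: sB.1.
  by exists 0, (eB j); rewrite add0r; split=> //; exact: sA.1.
move=> [a [b [Aa Bb ->]]]; apply: subspaceD; first exact: subspace_lspan.
  rewrite -AE in Aa; apply: lspan_mono Aa => _ [i _ <-].
  by exists (lshift m i).
rewrite -BE in Bb; apply: lspan_mono Bb => _ [i _ <-].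
by exists (rshift n i).
Qed.

(** Induction on [r]: independence of the summands makes the first of them meet
    the sum of the others only in 0, which is what [has_dimD] asks for. *)
Lemma has_dim_sum (r : seq nat) (W : nat -> set V) (d : nat -> nat) : uniq r ->
  (forall i, i \in r -> has_dim (W i) (d i)) ->
  (forall w : nat -> V, (forall i, i \in r -> W i (w i)) ->
     \sum_(i <- r) w i = 0 -> forall i, i \in r -> w i = 0) ->
  has_dim (sum_spaces r W) (\sum_(i <- r) d i)%N.
Proof.
elim: r => [_ _ _|i r IH /= /andP[ir ur] hW dir].
  rewrite big_nil [X in has_dim X _](_ : _ = [set 0]); first exact: has_dim0.
  apply/seteqP; split=> v; first by move=> [w [_ ->]]; rewrite big_nil.
  by move=> ->; exists (fun=> 0); rewrite big_nil.
have W0 j : j \in i :: r -> W j 0 by move=> /hW /has_dim_subspace [].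
have sub j : j \in r -> j \in i :: r by rewrite inE orbC => ->.
have neq j : j \in r -> (j == i) = false.
  by move=> jr; apply: contraNF ir => /eqP <-.
(* A family for [i :: r] out of a vector of [W i] and a family for [r]. *)
have glue (a : V) (w : nat -> V) : W i a -> (forall j, j \in r -> W j (w j)) ->
    let w' j := if j == i then a else w j in
    (forall j, j \in i :: r -> W j (w' j)) /\
    \sum_(j <- i :: r) w' j = a + \sum_(j <- r) w j.
  move=> Wa Ww w'; rewrite /w'; split=> [j|].
    by rewrite inE; have [->//|_] := eqVneq j i; exact: Ww.
  rewrite big_cons eqxx; congr (_ + _); apply: eq_big_seq => j /neq.
  by move=> ->.
have {}IH := IH ur (fun j jr => hW j (sub j jr)) _.
rewrite big_cons [X in has_dim X _](_ : _ =
    [set v | exists a b, [/\ W i a, sum_spaces r W b & v = a + b]]).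
  apply: has_dimD; first by apply: hW; rewrite mem_head.
    apply: IH => w Ww w0 j jr; have [Ww' s'] := glue 0 w (W0 i (mem_head _ _)) Ww.
    have := dir _ Ww'; rewrite s' w0 addr0 => /(_ erefl j (sub j jr)).
    by rewrite neq.
  move=> v Wv [w [Ww vE]]; rewrite {}vE in Wv *.
  have := has_dim_subspace (hW i (mem_head _ _)).
  move=> /subspaceN /(_ Wv) Wv'; have [Ww' s'] := glue _ w Wv' Ww.
  have := dir _ Ww'; rewrite s' addNr => /(_ erefl i (mem_head _ _)).
  by rewrite eqxx => /eqP; rewrite oppr_eq0 => /eqP.
apply/seteqP; split=> v.
  move=> [w [Ww ->]]; exists (w i), (\sum_(j <- r) w j); split.
  - by apply: Ww; rewrite mem_head.
  - by exists w; split=> // j /sub; exact: Ww.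
  - by rewrite big_cons.
move=> [a [_ [Wa [w [Ww ->]] ->]]]; have [Ww' s'] := glue a w Wa Ww.
by eexists; split; [exact: Ww' | rewrite s'].
Qed.

Lemma lspan_bigcup (r : seq nat) (B : nat -> set V) : uniq r ->
  lspan (\bigcup_(i in [set i | i \in r]) B i) =
  sum_spaces r (fun i => lspan (B i)).
Proof.
move=> ur; apply/seteqP; split=> v.
  apply: lspan_min => [|u [i ir Bu]].
    split; first by exists (fun=> 0); rewrite big1 //; split=> // i _; exact: (subspace_lspan _).1.
    move=> c _ _ [a [Ba ->]] [b [Bb ->]]; exists (fun i => c *: a i + b i).
    rewrite scaler_sumr -big_split; split=> // i ir.
    by apply: (subspace_lspan _).2; [exact: Ba | exact: Bb].
  exists (fun j => if j == i then u else 0); split=> [j jr|].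
    by case: eqP => [->|_]; [exact: lspan_incl | exact: (subspace_lspan _).1].
  rewrite (bigD1_seq i) //= eqxx big1 ?addr0 // => j /negPf ->.
  by [].
move=> [w [Bw ->]]; rewrite big_seq; apply: subspace_sum (subspace_lspan _) _ => i ir.
by apply: lspan_mono (Bw i ir) => u Bu; exists i.
Qed.
End Spans.

(** Forms that separate the points of [W] and admit a dual family in the span of
    [B] turn that family into a basis of [W]: [v] and [\sum_i l i v *: b i] have
    the same coordinates. *)
Lemma basis_of_dual_forms (R : realType) (V : lmodType R) (W B : set V) (n : nat)
    (l : 'I_n -> V -> R) :
  (forall i c u v, l i (c *: u + v) = c * l i u + l i v) ->
  is_subspace W -> B `<=` W ->
  (forall v, W v -> (forall i, l i v = 0) -> v = 0) ->
  (forall i, exists2 b, lspan B b & forall j, l j b = (j == i)%:R) ->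
  lspan B = W /\ has_dim W n.
Proof.
move=> lE sW BW linj lB.
have l0 j : l j 0 = 0.
  by have := lE j 1 0 0; rewrite scale1r addr0 mul1r => /eqP; rewrite -subr_eq subrr eq_sym => /eqP.
have lsum j (c : 'I_n -> R) (b : 'I_n -> V) :
    l j (\sum_(i < n) c i *: b i) = \sum_(i < n) c i * l j (b i).
  apply: (big_ind2 (fun u a => l j u = a)) => [//|u a v d <- <-|i _].
    by have := lE j 1 u v; rewrite scale1r mul1r.
  by have := lE j (c i) (b i) 0; rewrite l0 !addr0.
have sBW : lspan B `<=` W by exact: lspan_min.
pose b i := sval (cid2 (lB i)).
have bB i : lspan B (b i) by rewrite /b; case: cid2.
have lb j i : l j (b i) = (j == i)%:R by rewrite /b; case: cid2.
have lsumb j (c : 'I_n -> R) : l j (\sum_(i < n) c i *: b i) = c j.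
  rewrite lsum (bigD1 j) //= lb eqxx mulr1 big1 ?addr0 // => i /negPf ij.
  by rewrite lb eq_sym ij mulr0.
have Wb v : W v -> lspan (range b) v.
  move=> Wv; suff -> : v = \sum_(i < n) l i v *: b i.
    apply: subspace_sum (subspace_lspan _) _ => i _.
    by apply: subspaceZ (subspace_lspan _) _; apply: lspan_incl; exists i.
  apply/eqP; rewrite -subr_eq0 -scaleN1r addrC; apply/eqP/linj => [|j].
    apply: sW.2 => //; apply: subspace_sum => // i _.
    by apply: subspaceZ => //; exact: sBW.
  by rewrite lE lsumb mulN1r addNr.
split.
  apply/seteqP; split=> // v /Wb.
  by apply: (lspan_min (subspace_lspan _)) => _ [i _ <-].
exists b; split=> [c c0 j|]; first by rewrite -(lsumb j c) c0 l0.
apply/seteqP; split=> // v; apply: lspan_min => // _ [i _ <-].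
exact: sBW.
Qed.

(** * Monomials *)
Section Monomials.
Implicit Types (m : mon) (i : var).

Lemma mdiv_mul m m' : (forall i, (m' i <= m i)%N) -> m = mmul (divcm m m') m'.
Proof. by move=> le; apply: monP => i; rewrite monM_E divcmE subnK. Qed.

Lemma mdiv_var m i : m i != 0%N -> m = mmul (divcm m (mvar i)) (mvar i).
Proof.
move=> mi; apply: mdiv_mul => j; rewrite cmU.
by case: eqP => [<-|]//; rewrite lt0n.
Qed.

Lemma mon_ind (P : mon -> Prop) : P (mone : mon) ->
  (forall i m, P m -> P (mmul (mvar i) m)) -> forall m, P m.
Proof.
move=> P1 PM m; have [n] := ubnP (mdeg m); elim: n m => // n IH m mn.
have [/eqP m0|/fset0Pn[i im]] := boolP (finsupp m == fset0).
  suff -> : m = mone by [].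
  by apply: monP => i; rewrite mon1_E; apply/eqP; rewrite cmE_eq0 m0.
have mi : m i != 0%N by rewrite cmE_neq0.
rewrite (mdiv_var mi) mulmC; apply/PM/IH.
by move: mn; rewrite {1}(mdiv_var mi) mdegM mdegU addn1.
Qed.

Lemma weight1 (V : nmodType) (w : var -> V) : weight w (mone : mon) = 0.
Proof. by rewrite /weight mdom1 big_seq_fset0. Qed.

Lemma scalingM m m' : scaling (mmul m m') = scaling m + scaling m'.
Proof. exact: weightM. Qed.

Lemma noise_degM m m' : noise_deg (mmul m m') = (noise_deg m + noise_deg m')%N.
Proof. exact: weightM. Qed.

Lemma scalingU i : scaling (mvar i) =
  match i with inl k => 1 - k%:Z | inr k => - (1 + k%:Z) end.
Proof. exact: weightU. Qed.

Lemma noise_degU i : noise_deg (mvar i) = if i is inl _ then 1%N else 0%N.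
Proof. exact: weightU. Qed.

Lemma scaling_le0 m : m (inl 0%N) = 0%N -> scaling m <= 0.
Proof.
move=> m0; rewrite /scaling /weight; apply: sumr_le0 => -[[|k]|k] _.
- by rewrite m0 mulr0n.
- by apply: mulrn_wle0; lia.
- by apply: mulrn_wle0; lia.
Qed.

Definition xpow k n : mon := iter n (mmul (mvar (inl k))) (mone : mon).

Lemma xpowE k n i : xpow k n i = (n * ((inl k : var) == i))%N.
Proof. by elim: n => [|n IH] /=; rewrite ?mon1_E // monM_E cmU IH mulSn. Qed.

Lemma scaling_xpow k n : scaling (xpow k n) = n%:Z * (1 - k%:Z).
Proof.
elim: n => [|n IH] /=; first by rewrite /scaling weight1 mul0r.
by rewrite scalingM IH scalingU; lia.
Qed.

Lemma noise_deg_xpow k n : noise_deg (xpow k n) = n.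
Proof.
elim: n => [|n IH] /=; first by rewrite /noise_deg weight1.
by rewrite noise_degM IH noise_degU.
Qed.

(** Only x_0 has positive scaling, so it has to compensate for the [1 - k] that
    x_k contributes: this makes room for the factor [x_0 ^+ k.-1] that is split
    off in [hits_monomial], with at least one x_0 left. *)
Lemma x0_count m k : scaling m = 1 -> m (inl k) != 0%N -> (0 < k)%N ->
  (k <= m (inl 0%N))%N.
Proof.
move=> s mk k0; set a := m (inl 0%N).
pose u := mmul (xpow 0 a) (mvar (inl k)).
have uE : m = mmul (divcm m u) u.
  apply: mdiv_mul => i; rewrite monM_E xpowE cmU.
  have [<-|_] := eqVneq (inl 0%N : var) i.
    by case: eqP => [[E]|_] /=; [rewrite E in k0 | rewrite muln1 addn0].
  by rewrite muln0; case: eqP => [<-|//]; rewrite lt0n.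
have : scaling (divcm m u) <= 0.
  apply: scaling_le0; rewrite divcmE monM_E xpowE cmU eqxx muln1.
  by apply/eqP; rewrite subn_eq0 leq_addr.
move: s; rewrite {1}uE !scalingM scaling_xpow scalingU; lia.
Qed.

Definition xonly m := forall k, m (inr k) = 0%N.

Lemma xonlyM m m' : xonly (mmul m m') <-> xonly m /\ xonly m'.
Proof.
split=> [h|[h h'] k]; last by rewrite monM_E h h'.
by split=> k; have := h k; rewrite monM_E => /eqP; rewrite addn_eq0 => /andP[/eqP ? /eqP ?].
Qed.

Lemma xonly_scaling1 m : xonly m -> scaling m = 1 ->
  m = mvar (inl 0%N) \/ exists2 k, (0 < k)%N & m (inl k) != 0%N.
Proof.
move=> mx s; have [h|h] := pselect (exists2 k, (0 < k)%N & m (inl k) != 0%N).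
  by right.
left; have mE : m = xpow 0 (m (inl 0%N)).
  apply: monP => -[[|k]|k]; rewrite xpowE ?mx ?eqxx ?muln1 ?muln0 //.
  by apply/eqP/negPn/negP => mk; apply: h; exists k.+1.
have m1 : m (inl 0%N) = 1%N by move: s; rewrite {1}mE scaling_xpow; lia.
by rewrite mE m1; apply: monP => i; rewrite xpowE cmU mul1n.
Qed.
End Monomials.

(** * The span of B_N modulo the variables y_k *)

Section Polynomials.
Variable R : realType.
Local Notation pol := (pol R).
Implicit Types (p q v w : pol) (m : mon) (S : set mon).

Lemma pol_ind (P : pol -> Prop) : P 0 -> (forall p q, P p -> P q -> P (p + q)) ->
  (forall c m, P (c *: pmon R m)) -> forall p, P p.
Proof. by move=> P0 PD PZ p; rewrite (polE p); apply: big_ind. Qed.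

Lemma Dpol0 : Dpol (0 : pol) = 0.
Proof. by rewrite -(scale0r (0 : pol)) DpolZ !scale0r. Qed.

Lemma pmon1 : pmon R (mone : mon) = 1.
Proof. by []. Qed.

Lemma nabla_linearl (c : R) v v' w : nabla (c *: v + v') w = c *: nabla v w + nabla v' w.
Proof.
rewrite /nabla mulrDl mulrDr mulrDl -scalerAl -scalerAr -scalerAl !scalerDr.
by rewrite addrACA !scalerA [2^-1 * c]mulrC.
Qed.

Lemma nabla_linearr (c : R) v w w' : nabla v (c *: w + w') = c *: nabla v w + nabla v w'.
Proof.
rewrite /nabla DpolD DpolZ !mulrDr -!scalerAr !scalerDr.
by rewrite addrACA !scalerA [2^-1 * c]mulrC.
Qed.

Lemma nabla0 w : nabla 0 w = 0.
Proof. by rewrite /nabla mul0r mulr0 mul0r scaler0 addr0. Qed.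

Lemma nabla0r v : nabla v 0 = 0.
Proof. by rewrite /nabla Dpol0 !mulr0 scaler0 addr0. Qed.

Lemma lspan_nabla (A B C : set pol) :
  (forall v w, A v -> B w -> C (nabla v w)) ->
  forall v w, lspan A v -> lspan B w -> lspan C (nabla v w).
Proof.
move=> AB v w Av Bw; have sC := subspace_lspan C.
apply: (lspan_min (W := [set v | lspan C (nabla v w)])) Av.
  split=> [|c a b Ca Cb]; rewrite /mkset; first by rewrite nabla0; exact: subspace0 sC.
  by rewrite nabla_linearl; exact: (subspaceP c sC Ca Cb).
move=> {}v Av; apply: (lspan_min (W := [set w | lspan C (nabla v w)])) Bw.
  split=> [|c a b Ca Cb]; rewrite /mkset; first by rewrite nabla0r; exact: subspace0 sC.
  by rewrite nabla_linearr; exact: (subspaceP c sC Ca Cb).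
by move=> {}w Bw; apply/lspan_incl/AB.
Qed.

Definition mspan S : set pol := lspan (pmon R @` S).

Lemma mspan_pmon S m : S m -> mspan S (pmon R m).
Proof. by move=> Sm; apply: lspan_incl; exists m. Qed.

Lemma subspace_mspan S : is_subspace (mspan S).
Proof. exact: subspace_lspan. Qed.

Lemma mspan_mcoeff S p m : mspan S p -> ~ S m -> mcoeff m p = 0.
Proof.
move=> Sp Sm; move: Sp.
apply: (lspan_min (W := [set p | mcoeff m p = 0])) => [|_ [m' Sm' <-]].
  split=> [|c a b /= a0 b0]; first exact: mcoeff0.
  by rewrite mcoeffD mcoeffZ a0 b0 mulr0 addr0.
by rewrite /pmon /= mcoeffU; case: eqP => // E; case: Sm; rewrite -E.
Qed.

Lemma mspan_mul (S S' T : set mon) :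
  (forall m m', S m -> S' m' -> T (mmul m m')) ->
  forall p q, mspan S p -> mspan S' q -> mspan T (p * q).
Proof.
move=> ST p q Sp Sq; have sT := subspace_mspan T.
apply: (lspan_min (W := [set p | mspan T (p * q)])) Sp.
  split=> [|c a b Ca Cb]; rewrite /mkset; first by rewrite mul0r; exact: subspace0 sT.
  by rewrite mulrDl -scalerAl; exact: (subspaceP c sT Ca Cb).
move=> _ [m Sm <-]; apply: (lspan_min (W := [set q | mspan T (pmon R m * q)])) Sq.
  split=> [|c a b Ca Cb]; rewrite /mkset; first by rewrite mulr0; exact: subspace0 sT.
  by rewrite mulrDr -scalerAr; exact: (subspaceP c sT Ca Cb).
by move=> _ [m' Sm' <-]; rewrite /= -pmonM; apply/mspan_pmon/ST.
Qed.

Lemma mspan_D (S T : set mon) :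
  (forall m i, S m -> m i != 0%N ->
     T (mmul (divcm m (mvar i)) (mvar (succ_var i)))) ->
  forall p, mspan S p -> mspan T (Dpol p).
Proof.
move=> ST; have sT := subspace_mspan T.
apply: (lspan_min (W := [set p | mspan T (Dpol p)])) => [|_ [m Sm <-]].
  split=> [|c a b Ca Cb]; rewrite /mkset; first by rewrite Dpol0; exact: subspace0 sT.
  by rewrite DpolD DpolZ; exact: (subspaceP c sT Ca Cb).
rewrite /= Dpol_pmon /Dmon big_seq; apply: subspace_sum => // i im.
by apply: subspaceZ => //; apply/mspan_pmon/ST => //; rewrite cmE_neq0.
Qed.

Definition graded (s : int) (N : nat) : set pol :=
  mspan [set m | scaling m = s /\ noise_deg m = N].

Lemma graded_mul s t M N p q :
  graded s M p -> graded t N q -> graded (s + t) (M + N) (p * q).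
Proof.
apply: mspan_mul => m m' [<- <-] [<- <-] /=.
by rewrite scalingM noise_degM.
Qed.

Lemma graded_D s N p : graded s N p -> graded (s - 1) N (Dpol p).
Proof.
apply: mspan_D => m i [<- <-] mi /=.
rewrite {2 4}(mdiv_var mi) !scalingM !noise_degM !scalingU !noise_degU.
by case: i {mi} => k /=; lia.
Qed.

Lemma calB_graded N v : calB R N v -> (0 < N)%N /\ graded 1 N v.
Proof.
elim=> {N v} [|N k v w /andP[k1 kN] _ [_ gv] _ [_ gw]].
  by split=> //; apply: mspan_pmon => /=; rewrite scalingU noise_degU.
split=> //; have NE : N.+1 = (k + (N.+1 - k))%N by lia.
rewrite NE; apply: subspaceD; first exact: subspace_mspan.
  by rewrite [1](_ : _ = 1 + (1 - 1)) //; apply: graded_mul gv _; exact: graded_D.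
apply: subspaceZ; first exact: subspace_mspan.
rewrite [1](_ : _ = -1 + 1 + 1) // -[k]add0n; apply: graded_mul gw.
apply: graded_mul gv; apply: mspan_pmon => /=.
by rewrite scalingU noise_degU.
Qed.

Lemma calMN_graded N : (2 <= N)%N -> calMN R N = graded 1 N.
Proof.
move=> N2; apply: (congr1 (fun S => lspan (pmon R @` S))).
apply/seteqP; split=> m [/=]; first by move=> [].
by move=> s d; rewrite /monMN /monM /= d.
Qed.

Lemma graded_calM N : (2 <= N)%N -> graded 1 N `<=` calM R.
Proof.
move=> N2; apply: lspan_mono => _ [m [s d] <-]; exists m => //.
by rewrite /monM /= s d.
Qed.

(** The ideal generated by the y_k, as the span of the monomials in it. *)
Definition yideal : set pol := mspan [set m | ~ xonly m].

Lemma yideal_mulr p q : yideal p -> yideal (p * q).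
Proof.
move=> yp; have /= := @mspan_mul _ setT _ _ p q yp.
apply=> [m m' my _ /xonlyM[]//|].
elim/pol_ind: q => [|a b|c m]; first exact: subspace0 (subspace_mspan _).
  by apply: subspaceD; exact: subspace_mspan.
by apply: subspaceZ; [exact: subspace_mspan | exact: mspan_pmon].
Qed.

Lemma yideal_mull p q : yideal p -> yideal (q * p).
Proof. by rewrite mulrC; exact: yideal_mulr. Qed.

Lemma yideal_D p : yideal p -> yideal (Dpol p).
Proof.
apply: mspan_D => m i /= my mi /xonlyM[h h']; apply: my => k.
case: i mi h h' => [j|j] mi h h'; last by have := h' j.+1; rewrite cmUU.
by have := h k; rewrite divcmE cmU subn0.
Qed.

(** These [q] represent the image of the span of [calB R N] in the quotient by
    the ideal of the y_k; carrying the representative [p] along replaces the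
    quotient ring. *)
Definition hits N q := exists2 p, lspan (calB R N) p & yideal (p - q).

(** The next three identities are the ring computations behind [hits_nabla],
    [Dpol_exp] and [hits_monomial]: the error made when the factors [p] and [d]
    of a product are replaced by [a] and [h], the inductive step of
    [D (x^n) = n x^(n-1) D x], and the reduction of a monomial that contains the
    variable [t]. *)
Lemma leibniz_defect (A : comPzRingType) (p a d h t : A) :
  p * d + t - a * h = (p - a) * d + a * (d - h) + t.
Proof. ring. Qed.

Lemma leibniz_exp (A : comPzRingType) (x y : A) n :
  y * x ^+ n.+1 + x * ((x ^+ n * y) *+ n.+1) = (x ^+ n.+1 * y) *+ n.+2.
Proof. by rewrite mulrnAr mulrA -exprS [y * _]mulrC -mulrS. Qed.

Lemma novikov_step (A : comPzRingType) (a x y z t : A) k :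
  a * (x ^+ k.+1 * t) = - ((a * (x ^+ k * z) * y) *+ k.+1) +
    a * ((x ^+ k * y) *+ k.+1 * z + x ^+ k.+1 * t).
Proof.
rewrite mulrDr addrA mulrnAl mulrnAr [X in - (X *+ _)](_ : _ = a * (x ^+ k * y * z)).
  by rewrite addNr add0r.
by ring.
Qed.

(** Modulo the y_k, the term of [nabla] that contains y_0 disappears and what
    remains is the Novikov product. *)
Lemma hits_nabla M N a b : (0 < M)%N -> (0 < N)%N ->
  hits M a -> hits N b -> hits (M + N) (a * Dpol b).
Proof.
move=> M0 N0 [p Bp ya] [q Bq yb]; exists (nabla p q).
  apply: lspan_nabla Bp Bq => v w Bv Bw.
  have -> : (M + N = (M + N).-1.+1)%N by lia.
  apply: calB_S Bv _; first by lia.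
  by rewrite (_ : _ - M = N)%N //; lia.
have DB : Dpol (q - b) = Dpol q - Dpol b.
  by rewrite -[X in q + X]scaleN1r DpolD DpolZ scaleN1r.
rewrite /nabla -[vy R 0 * p * q]mulrA leibniz_defect -DB.
have sy := subspace_mspan [set m | ~ xonly m].
apply: subspaceD => //; first apply: subspaceD => //.
- exact: yideal_mulr.
- exact/yideal_mull/yideal_D.
- apply: subspaceZ => //; apply: yideal_mulr; apply: mspan_pmon => /= /(_ 0%N).
  by rewrite cmUU.
Qed.

Lemma hits_lin N c a b : hits N a -> hits N b -> hits N (c *: a + b).
Proof.
move=> [p Bp yp] [q Bq yq]; exists (c *: p + q).
  exact: (subspaceP c (subspace_lspan _) Bp Bq).
rewrite opprD addrACA -scalerN -scalerDr.
exact: (subspaceP c (subspace_mspan _) yp yq).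
Qed.

Lemma hits_x0 : hits 1 (vx R 0).
Proof.
exists (vx R 0); first by apply/lspan_incl/calB_1.
by rewrite subrr; exact: subspace0 (subspace_mspan _).
Qed.

Lemma pmon_xpow k n : pmon R (xpow k n) = vx R k ^+ n.
Proof. by elim: n => [|n IH] //=; rewrite pmonM IH exprS. Qed.

Lemma Dpol_exp p n : Dpol (p ^+ n.+1) = (p ^+ n * Dpol p) *+ n.+1.
Proof.
elim: n => [|n IH]; first by rewrite expr0 mul1r.
by rewrite exprS Dpol_mul IH; exact: leibniz_exp.
Qed.

(** The variables x_k generate nothing more than x_0 does: Novikov products of
    copies of x_0 already span all monomials of scaling 1 in the x_k. *)
Lemma hits_monomial N m : xonly m -> scaling m = 1 -> noise_deg m = N ->
  hits N (pmon R m).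
Proof.
elim/ltn_ind: N m => N IH m mx s d.
(* If no x_k with k >= 1 occurs, the scaling forces m to be x_0 itself. *)
have [mE|[k k0 mk]] := xonly_scaling1 mx s.
  by rewrite -d mE noise_degU; exact: hits_x0.
have x0k := x0_count s mk k0.
pose u := mmul (xpow 0 k.-1) (mvar (inl k)).
have [v mE v0] : exists2 v, m = mmul v u & v (inl 0%N) != 0%N.
  exists (divcm m u); last first.
    have kn0 : ((inl k : var) == inl 0%N) = false.
      by apply/eqP => -[E]; rewrite E in k0.
    rewrite divcmE monM_E xpowE cmU eqxx muln1 kn0 addn0 -lt0n subn_gt0.
    by apply: leq_trans x0k; rewrite prednK.
  apply: mdiv_mul => i; rewrite monM_E xpowE cmU.
  have [<-|_] := eqVneq (inl 0%N : var) i.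
    case: eqP => [[E]|_] /=; first by rewrite E in k0.
    by rewrite muln1 addn0 (leq_trans (leq_pred k)).
  by rewrite muln0; case: eqP => [<-|//]; rewrite lt0n.
have [vX uX] : xonly v /\ xonly u by apply/xonlyM; rewrite -mE.
have vs : scaling v = 1.
  by move: s; rewrite mE !scalingM scaling_xpow scalingU; lia.
have vd : noise_deg v = (N - k)%N.
  by move: d; rewrite mE !noise_degM noise_deg_xpow noise_degU; lia.
have vd0 : (0 < noise_deg v)%N.
  by rewrite (mdiv_var v0) noise_degM noise_degU addn1.
have hv : hits (N - k) (pmon R v) by apply: IH => //; lia.
have mpE : pmon R m = pmon R v * (vx R 0 ^+ k.-1 * vx R k).
  by rewrite mE !pmonM pmon_xpow.
clear uX mk x0k mE u.
(* For k = 1 the monomial is v D x_0, without a correction term. *)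
case: k => [//|[|k]] in k0 vd hv mpE *.
  rewrite mpE expr0 mul1r -Dpol_vx (_ : N = N - 1 + 1)%N; last by lia.
  by apply: hits_nabla hits_x0 => //; lia.
pose w := mmul (xpow 0 k.+1) (mvar (inl k.+1)).
have wX : xonly w.
  by move=> j; rewrite monM_E xpowE cmU muln0.
have hw : hits k.+2 (pmon R w).
  apply: IH => //; first by lia.
    by rewrite scalingM scaling_xpow scalingU; lia.
  by rewrite noise_degM noise_deg_xpow noise_degU; lia.
pose m' := mmul v (mmul (xpow 0 k) (mvar (inl k.+1))).
have hm' : hits (N - 1) (pmon R m').
  apply: IH; first by lia.
  - by apply/xonlyM; split=> // j; rewrite monM_E xpowE cmU muln0.
  - by rewrite !scalingM scaling_xpow scalingU; lia.
  - by rewrite !noise_degM noise_deg_xpow noise_degU; lia.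
have h1 : hits N (pmon R v * Dpol (pmon R w)).
  by rewrite (_ : N = N - k.+2 + k.+2)%N; [apply: hits_nabla => //; lia | lia].
have h2 : hits N (pmon R m' * Dpol (vx R 0)).
  rewrite (_ : N = N - 1 + 1)%N; last by lia.
  by apply: hits_nabla hits_x0 => //; lia.
suff -> : pmon R m = - k.+1%:R *: (pmon R m' * Dpol (vx R 0)) + pmon R v * Dpol (pmon R w).
  exact: hits_lin h2 h1.
have wE : pmon R w = vx R 0 ^+ k.+1 * vx R k.+1 by rewrite pmonM pmon_xpow.
have m'E : pmon R m' = pmon R v * (vx R 0 ^+ k * vx R k.+1).
  rewrite /m' pmonM (pmonM R (xpow 0 k)) pmon_xpow.
  reflexivity.
rewrite mpE wE m'E Dpol_mul Dpol_exp !Dpol_vx scaleNr scaler_nat.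
exact: novikov_step.
Qed.
End Polynomials.

(** * Polynomials as functions on jets *)
Section Evaluation.
Variable R : realType.
Local Notation pol := (pol R).
Implicit Types (c : var -> R) (p q v w : pol) (m : mon).

Definition evm c m : R := \prod_(i <- finsupp m) c i ^+ m i.
Definition ev c v : R := \sum_(m <- msupp v) mcoeff m v * evm c m.

Lemma evmEw c (d : {fset var}) m : (finsupp m `<=` d)%fset ->
  evm c m = \prod_(i <- d) c i ^+ m i.
Proof.
move=> le; apply: big_fset_incl => // i _; rewrite -cmE_eq0 => /eqP ->.
by rewrite expr0.
Qed.

Lemma evm1 c : evm c (mone : mon) = 1.
Proof. by rewrite /evm mdom1 big_seq_fset0. Qed.

Lemma evmU c i : evm c (mvar i) = c i.
Proof. by rewrite /evm mdomU big_seq_fset1 cmUU. Qed.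

Lemma evmM c m m' : evm c (mmul m m') = evm c m * evm c m'.
Proof.
rewrite (evmEw c (d := finsupp (mmul m m'))) //.
have le1 : (finsupp m `<=` finsupp (mmul m m'))%fset by rewrite finsuppM fsubsetUl.
have le2 : (finsupp m' `<=` finsupp (mmul m m'))%fset by rewrite finsuppM fsubsetUr.
rewrite (evmEw c le1) (evmEw c le2) -big_split /=; apply: eq_bigr => i _.
by rewrite monM_E exprD.
Qed.

Lemma evE c v : ev c v = mmap idfun (evm c) v.
Proof. by []. Qed.

Lemma ev0 c : ev c 0 = 0.
Proof. by rewrite evE raddf0. Qed.

Lemma evD c p q : ev c (p + q) = ev c p + ev c q.
Proof. by rewrite !evE raddfD. Qed.

Lemma evZ c (a : R) p : ev c (a *: p) = a * ev c p.
Proof.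
rewrite evE (mmapEw (msuppZ_le _ _)) mulr_sumr; apply: eq_bigr => m _.
by rewrite mcoeffZ mulrA.
Qed.

Lemma ev_pmon c m : ev c (pmon R m) = evm c m.
Proof. by rewrite evE mmapU mul1r. Qed.

Lemma evM c p q : ev c (p * q) = ev c p * ev c q.
Proof.
elim/pol_ind: p => [|p p' h h'|a m].
- by rewrite mul0r ev0 mul0r.
- by rewrite mulrDl !evD h h' mulrDl.
elim/pol_ind: q => [|q q' h h'|b m'].
- by rewrite mulr0 ev0 mulr0.
- by rewrite mulrDr !evD h h' mulrDr.
by rewrite -scalerAl -scalerAr -pmonM !evZ !ev_pmon evmM; ring.
Qed.

Lemma eq_ev c c' v :
  (forall m i, m \in msupp v -> i \in finsupp m -> c i = c' i) ->
  ev c v = ev c' v.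
Proof.
move=> cc'; apply: eq_big_seq => m mv; congr (_ * _).
by apply: eq_big_seq => i im; rewrite (cc' m).
Qed.

(** An injective sequence of primes: when the variables are specialised to
    distinct primes, monomials take distinct values by unique factorisation. *)
Fixpoint nth_prime n : nat :=
  if n is n'.+1 then s2val (prime_above (nth_prime n')) else 2%N.

Lemma prime_nth_prime n : prime (nth_prime n).
Proof. by case: n => //= n; case: (prime_above _). Qed.

Lemma nth_prime_inj : injective nth_prime.
Proof.
have lt : {homo nth_prime : m n / (m < n)%N}.
  by apply: homo_ltn => [? ? ? | n /=]; [exact: ltn_trans | case: (prime_above _)].
by move=> m n E; case: (ltngtP m n) => // /lt; rewrite E ltnn.
Qed.

Definition var_prime (i : var) : nat :=
  match i with inl k => nth_prime k.*2 | inr k => nth_prime k.*2.+1 end.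

(** A polynomial is determined by its values. Evaluating at the powers
    [p_i ^+ s] of distinct primes gives [\sum_m v_m (X m) ^+ s = 0] for all [s],
    where the numbers [X m] are distinct; then [\sum_m v_m q(X m) = 0] for
    every univariate [q], and taking for [q] a product that vanishes at all
    other [X m'] isolates the coefficient [v_m]. *)
Lemma ev_eq0 v : (forall c, ev c v = 0) -> v = 0.
Proof.
move=> v0; apply/malgP => m; rewrite mcoeff0.
pose X (m : mon) : R := evm (fun i => (var_prime i)%:R) m.
have Xinj : injective X.
  have vp i j : logn (var_prime i) (var_prime j) = (j == i).
    have vpr i' : prime (var_prime i') by case: i' => k; exact: prime_nth_prime.
    rewrite logn_prime //; congr nat_of_bool.
    apply/eqP/eqP => [|-> //]; case: i j => [k|k] [l|l];
      rewrite /var_prime => /nth_prime_inj E.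
    - by congr inl; lia.
    - by exfalso; lia.
    - by exfalso; lia.
    - by congr inr; lia.
  have XE m' : exists n, [/\ (0 < n)%N, X m' = n%:R &
      forall i, logn (var_prime i) n = m' i].
    elim/mon_ind: m' => [|i m' [n [n0 Xn ln]]].
      by exists 1%N; split=> [//||i]; rewrite ?/X ?evm1 ?logn1 ?mon1_E.
    have p0 : (0 < var_prime i)%N by case: i => k; exact/prime_gt0/prime_nth_prime.
    exists (var_prime i * n)%N; split=> [||j]; first by rewrite muln_gt0 p0.
      by rewrite /X evmM evmU -/(X _) Xn natrM.
    by rewrite lognM // vp ln monM_E cmU.
  move=> m1 m2; have [n1 [_ -> l1]] := XE m1; have [n2 [_ -> l2]] := XE m2.
  move=> /eqP; rewrite eqr_nat => /eqP n12; apply: monP => i.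
  by rewrite -l1 -l2 n12.
have powX s : \sum_(m' <- msupp v) mcoeff m' v * X m' ^+ s = 0.
  rewrite -[RHS](v0 (fun i => (var_prime i)%:R ^+ s)); apply: eq_bigr => m' _.
  congr (_ * _); rewrite /X /evm -prodrXl; apply: eq_bigr => i _.
  by rewrite exprAC.
have polX (p : {poly R}) : \sum_(m' <- msupp v) mcoeff m' v * p.[X m'] = 0.
  under eq_bigr do rewrite horner_coef mulr_sumr.
  rewrite exchange_big big1 // => k _ /=.
  under eq_bigr do rewrite mulrCA; by rewrite -mulr_sumr powX mulr0.
have [mv|] := boolP (m \in msupp v); last by move=> /mcoeff_outdom.
pose p := \prod_(m' <- msupp v | m' != m) ('X - (X m')%:P).
have pE : \sum_(m' <- msupp v | m' != m) mcoeff m' v * p.[X m'] = 0.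
  rewrite big_seq_cond big1 // => m' /andP[m'v m'm].
  rewrite horner_prod (big_rem m') //= m'm hornerXsubC subrr mul0r mulr0 //.
have := polX p; rewrite (bigD1_seq m) //= pE addr0 => /eqP.
rewrite mulf_eq0 => /orP[/eqP//|]; rewrite horner_prod prodf_seq_eq0.
move=> /hasP[m' _ /andP[m'm]]; rewrite hornerXsubC subr_eq0 => /eqP /Xinj E.
by rewrite E eqxx in m'm.
Qed.
End Evaluation.

(** * Covariance and invariance under diffeomorphisms *)
Section Covariance.
Variable R : realType.
Local Notation pol := (pol R).
Implicit Types (Gamma sigma f : R -> R) (phi : diffeo R) (v w : pol).

Definition jet Gamma sigma (u : R) (i : var) : R :=
  match i with inl k => sigma^`(k)%classic u | inr k => 2 * Gamma^`(k)%classic u end.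

Lemma UpsilonE Gamma sigma v u : Upsilon Gamma sigma v u = ev (jet Gamma sigma u) v.
Proof. by []. Qed.

Section Jets.
Variables (Gamma sigma : R -> R).
Hypotheses (sG : smooth Gamma) (ss : smooth sigma).
Let Y v : R -> R := Upsilon Gamma sigma v.
Let good v := smooth (Y v) /\ (Y v)^`()%classic = Y (Dpol v).

Let goodM v w : good v -> good w -> good (v * w).
Proof.
move=> [sv Dv] [sw Dw].
have E : Y (v * w) = fun u => Y v u * Y w u by apply/funext => u; exact: evM.
split; first by rewrite E; exact: smoothM.
apply/funext => u; rewrite E derive1M; [|exact: smooth_derivable..].
by rewrite Dv Dw Dpol_mul /Y !UpsilonE evD !evM.
Qed.

Let good_var i : good (pmon R (mvar i)).
Proof.
have E : Y (pmon R (mvar i)) = fun u => jet Gamma sigma u i.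
  by apply/funext => u; rewrite /Y UpsilonE ev_pmon evmU.
have DE : Y (Dpol (pmon R (mvar i))) = fun u => jet Gamma sigma u (succ_var i).
  apply/funext => u; rewrite /Y UpsilonE -evmU -ev_pmon; congr ev.
  by case: i {E} => k; [exact: Dpol_vx | exact: Dpol_vy].
rewrite /good E DE; case: i {E DE} => k /=.
  by split; [exact: smooth_derive1n | reflexivity].
have sGk := smooth_derive1n (n := k) sG.
split; first exact: smoothM (smooth_cst (c := 2)) sGk.
apply/funext => u; rewrite (derive1M (f := fun=> 2)).
- by rewrite derive1_cst mul0r add0r.
- exact: derivable_cst.
- exact: smooth_derivable.
Qed.

(** The derivation [Dpol] is the differentiation of functions: both obey the
    Leibniz rule and they agree on the variables. *)
Lemma Upsilon_smooth_derive v :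
  smooth (Upsilon Gamma sigma v) /\
  (Upsilon Gamma sigma v)^`()%classic = Upsilon Gamma sigma (Dpol v).
Proof.
suff : good v by [].
have good_cst (a : R) : good (a *: 1).
  have E : Y (a *: 1) = fun=> a.
    by apply/funext => u; rewrite /Y UpsilonE evZ -pmon1 ev_pmon evm1 mulr1.
  split; first by rewrite E; exact: smooth_cst.
  rewrite E DpolZ -pmon1 Dpol_pmon /Dmon mdom1 big_seq_fset0 scaler0.
  by apply/funext => u; rewrite derive1_cst /Y UpsilonE ev0.
elim/pol_ind: v => [|p q [sp Dp] [sq Dq]|a m].
- by rewrite -[0](scale0r 1).
- have E : Y (p + q) = fun u => Y p u + Y q u by apply/funext => u; exact: evD.
  split; first by rewrite E; exact: smoothD.
  rewrite E; have /= -> := derive1nD 1 sp sq.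
  by apply/funext => u; rewrite Dp Dq DpolD /Y !UpsilonE evD.
elim/mon_ind: m => [|i m gm]; first by rewrite pmon1.
by rewrite pmonM scalerAr; exact: goodM (good_var i) gm.
Qed.
End Jets.

Lemma smooth_act_vf phi f : smooth f -> smooth (act_vf phi f).
Proof.
move=> sf; have s1 : smooth phi^`()%classic by apply: smooth_derive1; exact: dfun_smooth.
exact: (smooth_comp (@dinv_smooth R phi) (smoothM s1 sf)).
Qed.

Lemma smooth_act_Gamma phi Gamma : smooth Gamma -> smooth (act_Gamma phi Gamma).
Proof.
move=> sG; have s1 : smooth phi^`()%classic by apply: smooth_derive1; exact: dfun_smooth.
have s2 : smooth phi^`(2)%classic by exact: smooth_derive1.
have sV : smooth (fun u => (phi^`()%classic u ^+ 2)^-1).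
  apply: smoothV => [u|]; first by rewrite expf_neq0 // diffeo_derive_neq0.
  exact: (smoothM s1 s1).
have sN : smooth (fun u => - phi^`(2)%classic u).
  rewrite (_ : (fun _ => _) = fun u => -1 * phi^`(2)%classic u).
    exact: smoothM (smooth_cst (c := -1)) s2.
  by apply/funext => u; rewrite mulN1r.
exact: (smooth_comp (@dinv_smooth R phi) (smoothM (smoothD (smoothM s1 sG) sN) sV)).
Qed.

(** Write [a = phi'], [b = phi''] at [u]. For vector fields [X], [Y] with
    transforms [aX] and [aY] at [phi u], the chain rule turns the derivative of
    the latter into [(bY + aY') / a], and the connection [G] at [phi u] has
    [G a^2 = a Gamma - b]; in the covariant derivative the two terms [bXY]
    cancel and [a (XY' + Gamma XY)] remains. *)
Lemma calB_covariant N v : calB R N v ->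
  forall Gamma sigma, smooth Gamma -> smooth sigma -> forall phi,
  act_vf phi (Upsilon Gamma sigma v) =
  Upsilon (act_Gamma phi Gamma) (act_vf phi sigma) v.
Proof.
move=> Bv Gamma sigma sG ss phi.
have sG' := smooth_act_Gamma (phi := phi) sG; have ss' := smooth_act_vf (phi := phi) ss.
elim: Bv => {N v} [|N k v w _ _ hv _ hw]; apply/funext => y; rewrite -(@dinvK R phi y);
  move: (Defs.dinv phi y) => u; rewrite act_vfE.
  rewrite !UpsilonE !ev_pmon !evmU /=.
  by rewrite act_vfE.
have [sw Dw] := Upsilon_smooth_derive sG ss w.
have [sw' Dw'] := Upsilon_smooth_derive sG' ss' w.
have nE G s x : Upsilon G s (nabla v w) x =
    Upsilon G s v x * Upsilon G s (Dpol w) x +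
    G x * (Upsilon G s v x * Upsilon G s w x).
  by rewrite !UpsilonE /nabla evD evZ !evM ev_pmon evmU /=; field.
rewrite !nE -Dw -Dw' -hv -hw !act_vfE.
have chain : (act_vf phi (Upsilon Gamma sigma w))^`()%classic (phi u) * phi^`()%classic u =
    phi^`(2)%classic u * Upsilon Gamma sigma w u +
    phi^`()%classic u * (Upsilon Gamma sigma w)^`()%classic u.
  have sphi : smooth phi by exact: dfun_smooth.
  rewrite -derive1_compE; first last.
  - by apply: smooth_derivable; exact: smooth_act_vf.
  - exact: smooth_derivable.
  rewrite (_ : (fun _ => _) = fun x => phi^`()%classic x * Upsilon Gamma sigma w x).
    rewrite derive1M; [reflexivity| |exact: smooth_derivable].
    exact: smooth_derivable (smooth_derive1 sphi).
  by apply/funext => x; rewrite act_vfE.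
have GE := act_GammaE phi Gamma u.
move: chain GE; set a := phi^`()%classic u; set b := phi^`(2)%classic u.
set X := Upsilon _ _ v u; set Y := Upsilon _ _ w u; set Y' := derive1 (Upsilon _ _ w) u.
set Z := derive1 _ (phi u); set G := act_Gamma _ _ _ => chain GE.
transitivity (X * (Z * a) + (G * a ^+ 2) * (X * Y)); last by ring.
by rewrite chain GE; ring.
Qed.

Lemma subspace_Vgeo : is_subspace (Vgeo R).
Proof.
split=> [|c v w [Mv hv] [Mw hw]].
  split; first exact: (subspace_lspan _).1.
  move=> Gamma sigma _ _ phi _; apply/funext => y.
  by rewrite /act_vf !UpsilonE !ev0 mulr0.
split; first by apply: (subspace_lspan _).2.
move=> Gamma sigma sG ss phi hphi; apply/funext => y.
have := congr1 (@^~ y) (hv _ _ sG ss phi hphi).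
have := congr1 (@^~ y) (hw _ _ sG ss phi hphi).
rewrite /act_vf /= !UpsilonE !evD !evZ => <- <-; ring.
Qed.

Lemma poly_with_jet (c : nat -> R) K : exists p : {poly R},
  forall k, (k < K)%N -> (horner p)^`(k)%classic 0 = c k.
Proof.
exists (\poly_(k < K) (c k / k`!%:R)) => k kK.
rewrite derive1n_horner horner_coef0 coef_derivn addn0 ffactnn coef_poly kK.
by rewrite -[LHS]mulr_natr divfK // pnatr_eq0 -lt0n fact_gt0.
Qed.

(** The coefficients of the power series solution of [s' = P s], [s(0) = 1] are
    determined one after the other; [s] is a truncation of it. *)
Lemma truncated_exponential (P : {poly R}) K : exists s r : {poly R},
  s.[0] = 1 /\ s^`() - P * s = 'X^K * r.
Proof.
elim: K => [|K [s [r [s0 sE]]]].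
  by exists 1, (- P); rewrite hornerC derivC mulr1 sub0r expr0 mul1r.
have [r1 rE] : exists r1, r = r1 * 'X + (r`_0)%:P.
  exists (r %/ 'X); rewrite {1}(divp_eq r 'X); congr (_ + _).
  by rewrite -['X]subr0 modp_XsubC horner_coef0.
(* The coefficient that cancels the lowest term of the error 'X^K * r. *)
pose a : R := - r`_0 / K.+1%:R.
exists (s + a *: 'X^(K.+1)), (r1 - a *: P); split.
  by rewrite hornerD hornerZ hornerXn expr0n mulr0 addr0.
rewrite derivD derivZ derivXn /= mulrDr opprD addrACA sE {1}rE.
have aE : a *: ('X^K *+ K.+1) = - (r`_0)%:P * 'X^K :> {poly R}.
  rewrite -scaler_nat scalerA /a divfK ?pnatr_eq0 // -mul_polyC; congr (_ * _).
  by rewrite polyCN.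
rewrite aE exprS -!mul_polyC.
by move: (a%:P) ((r`_0)%:P) 'X^K => b c T; ring.
Qed.

Lemma poly_antiderivative (q : {poly R}) : exists F : {poly R}, deriv F = q.
Proof.
exists (\sum_(i < size q) (q`_i / i.+1%:R) *: 'X^(i.+1)).
rewrite raddf_sum -[RHS]coefK poly_def; apply: eq_bigr => i _.
have qE : q`_i / i.+1%:R *+ i.+1 = q`_i.
  by rewrite -[LHS]mulr_natr divfK // pnatr_eq0.
by rewrite /= derivZ derivXn /= -scalerMnr scalerMnl qE.
Qed.

(** [Gamma = phi'' / phi'] is carried to 0 by [phi], so it remains to choose the
    derivative [q = phi'], a positive polynomial with [q' / q] close to a
    polynomial [P] that has the required jet. With [s' = (P / 2) s] up to order
    [K] at 0 and [s(0) = 1], the polynomial [s^2 + x^(2K+2)] has [q' = P q] up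
    to order [K]; it is positive everywhere, and at least 1 outside [-1, 1], so
    that its antiderivative [phi] is onto. *)
Lemma flat_connection_with_jet (c : nat -> R) K : exists phi Gamma,
  [/\ smooth Gamma, homotopic R idfun phi, act_Gamma phi Gamma = fun=> 0 &
   forall k, (k < K)%N -> Gamma^`(k)%classic 0 = c k].
Proof.
have [P Pc] := poly_with_jet c K.
have [s [r [s0 sE]]] := truncated_exponential (2^-1 *: P) K.
pose q : {poly R} := s ^+ 2 + ('X^(K.+1)) ^+ 2.
have qE (u : R) : q.[u] = s.[u] ^+ 2 + (u ^+ K.+1) ^+ 2.
  by rewrite hornerD !horner_exp hornerX.
have q0 (u : R) : 0 < q.[u].
  rewrite qE; have [->|u0] := eqVneq u 0.
    by rewrite s0 expr1n expr0n /= expr0n addr0 ltr01.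
  by rewrite ltr_wpDl ?sqr_ge0 // exprn_even_gt0 //= expf_neq0.
have q1 (u : R) : 1 <= `|u| -> 1 <= q.[u].
  move=> u1; rewrite qE ler_wpDl ?sqr_ge0 // -real_normK ?num_real // normrX.
  by rewrite -exprM exprn_ege1.
have [r' qr] : exists r', deriv q = P * q + 'X^K * r'.
  have s'E : deriv s = 2^-1 *: P * s + 'X^K * r by rewrite -sE addrCA subrr addr0.
  exists (r * s + s * r + ('X^(K.+1) *+ K.+1) *+ 2 - P * 'X * 'X^(K.+1)).
  have PE : P = 2^-1 *: P + 2^-1 *: P by rewrite -scalerDl (_ : 2^-1 + 2^-1 = 1) ?scale1r //; lra.
  rewrite /q !expr2 derivD !derivM derivXn s'E /= exprS.
  move: (2^-1 *: P) PE 'X^K => Q -> T.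
  by rewrite -mulr_natr -[_ *+ K.+1]mulr_natr; ring.
have [F FE] := poly_antiderivative q.
have F'E : (horner F)^`()%classic = horner q by rewrite -derivE FE.
have [phi phiE] : exists phi : diffeo R, dfun phi = horner F.
  apply: diffeo_of_derive_gt0 => [||y]; first exact: smooth_horner.
    by move=> u; rewrite F'E.
  have growth (a b : R) : a <= b -> (b <= -1) || (1 <= a) ->
      b - a <= F.[b] - F.[a].
    move=> ab ab1.
    have [x _||x xab ->] := @MVT_segment R (horner F) (horner q) a b ab.
    - by rewrite -FE; exact: is_derive_poly.
    - exact/continuous_subspaceT/continuous_horner.
    rewrite ler_peMl ?subr_ge0 // q1 //; move: xab; rewrite in_itv /= => /andP[ac cb].
    by case/orP: ab1 => h; rewrite ler_normr; apply/orP; [right|left]; lra.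
  exists (- 1 - `|y - F.[-1]|), (1 + `|y - F.[1]|).
  have := growth (- 1 - `|y - F.[-1]|) (-1).
  have := growth 1 (1 + `|y - F.[1]|).
  have := ler_norm (y - F.[1]); have := ler_norm (- (y - F.[-1])); rewrite normrN.
  have := normr_ge0 (y - F.[1]); have := normr_ge0 (y - F.[-1]).
  rewrite !lexx orbT /=.
  set u := `|_ - F.[-1]|; set w := `|_ - F.[1]| => u0 w0 hu hw.
  move=> /(_ _ isT) h1 /(_ _ isT) h2.
  have {}h1 : 1 + w - 1 <= F.[1 + w] - F.[1] by apply: h1; lra.
  have {}h2 : -1 - (-1 - u) <= F.[-1] - F.[-1 - u] by apply: h2; lra.
  by apply/andP; split; lra.
pose h u := r'.[u] / q.[u].
have sh : smooth h.
  apply: (smoothM (f := horner r')); first exact: smooth_horner.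
  by apply: smoothV => [u|]; [rewrite gt_eqF | exact: smooth_horner].
have GE : (fun u => (deriv q).[u] / q.[u]) = fun u => P.[u] + u ^+ K * h u.
  apply/funext => u; rewrite qr hornerD !hornerM hornerXn mulrDl mulfK ?gt_eqF //.
  by rewrite mulrA.
have sX : smooth (fun u : R => u ^+ K * h u).
  have sXK : smooth (fun u : R => u ^+ K).
    have := @smooth_horner R 'X^K; congr smooth.
    by apply/funext => x; rewrite hornerXn.
  exact: smoothM sXK sh.
exists phi, (fun u => (deriv q).[u] / q.[u]); split.
- by rewrite GE; exact: smoothD (@smooth_horner R P) sX.
- by rewrite phiE; apply: homotopic_continuous; exact: continuous_horner.
- apply/funext => y; rewrite /act_Gamma phiE F'E derive1nS /= F'E -derivE.
  by rewrite mulrCA divff ?gt_eqF // mulr1 subrr mul0r.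
- move=> k kK; rewrite GE (derive1nD k (@smooth_horner R P) sX).
  by rewrite (Pc k kK) (derive1n_Xn_mul sh kK) addr0.
Qed.
End Covariance.

(** * Geometric elements *)

Section Dimension.
Variable R : realType.
Local Notation pol := (pol R).

(** For the connection 0, [Upsilon] sends every monomial that contains some y_k
    to 0; covariance carries this over to all flat connections, whose jets are
    arbitrary. *)
Lemma Vgeo_xonly_eq0 (v : pol) : Vgeo R v ->
  (forall m, xonly m -> mcoeff m v = 0) -> v = 0.
Proof.
move=> [_ inv] vx0; apply: ev_eq0 => c.
(* A bound K for the order of the derivatives that occur in v. *)
pose rank (i : var) := match i with inl k => k | inr k => k end.
pose Km (m : mon) := (\max_(i <- finsupp m) (rank i).+1)%N.
pose K := (\max_(m <- msupp v) Km m)%N.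
have rankK m i : m \in msupp v -> i \in finsupp m -> (rank i < K)%N.
  move=> mv im; apply: (@leq_trans (Km m)).
    exact: (@leq_bigmax_seq _ _ xpredT (fun i => (rank i).+1)).
  exact: (@leq_bigmax_seq _ _ xpredT Km).
have [phi [Gamma [sG hphi flat jG]]] :=
  flat_connection_with_jet (fun k => c (inr k) / 2) K.
have [p jp] := poly_with_jet (fun k => c (inl k)) K.
have := congr1 (@^~ (phi 0)) (inv Gamma (horner p) sG (@smooth_horner R p) phi hphi).
rewrite /= act_vfE flat => E.
have /eqP : phi^`()%classic 0 * Upsilon Gamma (horner p) v 0 = 0.
  rewrite E UpsilonE /ev big1_seq // => m /andP[_ mv].
  have [k mk] : exists k, m (inr k) != 0%N.
    apply: contrapT => nk; move: mv; rewrite -mcoeff_neq0 vx0 ?eqxx // => k.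
    by apply/eqP/negPn/negP => mk; apply: nk; exists k.
  have derive0 j : ((fun=> 0) : R -> R)^`(j)%classic = fun=> 0.
    elim: j => // j IH; rewrite derive1nS IH; apply/funext => x; exact: derive1_cst.
  rewrite /evm (big_fsetD1 (inr k)) -?cmE_neq0 //= derive0.
  by rewrite mulr0 expr0n (negPf mk) mul0r mulr0.
rewrite mulf_eq0 (negPf (diffeo_derive_neq0 _ _)) /= UpsilonE => /eqP E0.
rewrite -[RHS]E0; apply: eq_ev => m [k|k] mv im /=; have kK := rankK _ _ mv im.
  by rewrite jp.
by rewrite jG // mulrC divfK.
Qed.

Lemma subspace_VgeoN N : is_subspace (VgeoN R N).
Proof.
split; first by split; [exact: subspace0 (@subspace_Vgeo R) | exact: subspace0 (subspace_lspan _)].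
move=> c v w [Gv Mv] [Gw Mw]; split.
  exact: (subspaceP c (@subspace_Vgeo R) Gv Gw).
exact: (subspaceP c (subspace_lspan _) Mv Mw).
Qed.

Lemma calB_VgeoN N : (2 <= N)%N -> calB R N `<=` VgeoN R N.
Proof.
move=> N2 v Bv; have [_ gv] := calB_graded Bv.
split; last by rewrite calMN_graded.
split; first exact: graded_calM N2 _ gv.
by move=> Gamma sigma sG ss phi _; exact: calB_covariant Bv _ _ sG ss phi.
Qed.

(** The coordinates are the coefficients of the monomials of [monXi N]; the dual
    family comes from [hits_monomial]. *)
Lemma span_calB N : (2 <= N)%N ->
  lspan (calB R N) = VgeoN R N /\ has_dim (VgeoN R N) (cardXi N).
Proof.
move=> N2; pose s : seq mon := enum_fset (fset_set (monXi N)).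
have us : uniq s by exact: fset_uniq.
have sP m : (m \in s) = `[< monXi N m >].
  have := in_fset_set (finite_monXi N) m; rewrite /s => ->.
  by apply/idP/asboolP => [/set_mem|/mem_set].
pose mth (i : 'I_(cardXi N)) : mon := nth (mone : mon) s i.
have mthP i : monXi N (mth i) by apply/asboolP; rewrite -sP mem_nth.
apply: (@basis_of_dual_forms R _ _ _ _ (fun i v => mcoeff (mth i) v)).
- by move=> i c u v; rewrite mcoeffD mcoeffZ.
- exact: subspace_VgeoN.
- exact: calB_VgeoN.
- move=> v [Gv Mv] v0; apply: Vgeo_xonly_eq0 Gv _ => m mx.
  have [mN|mN] := pselect (monMN N m); last exact: mspan_mcoeff Mv mN.
  have ms : m \in s by rewrite sP; apply/asboolP.
  have mi : (index m s < cardXi N)%N by rewrite /cardXi index_mem.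
  by have := v0 (Ordinal mi); rewrite /mth /= nth_index.
- move=> i; have [[[mis _] mid] mix] := mthP i.
  have [b Bb yb] := hits_monomial R mix mis mid.
  exists b => // j; have [_ mjx] := mthP j.
  have : mcoeff (mth j) (b - pmon R (mth i)) = 0.
    by apply: mspan_mcoeff yb _ => /=; apply.
  rewrite mcoeffB => /eqP; rewrite subr_eq0 => /eqP ->.
  rewrite /pmon mcoeffU; congr (_%:R).
  by rewrite /mth nth_uniq // eq_sym -val_eqE.
Qed.

(** For the levels used with a general noise [f] is the identity, and for a
    Gaussian noise it is multiplication by 2; the left inverse [g] transports
    [sum_VgeoN_direct] to families indexed by [r]. *)
Lemma span_calB_levels (r : seq nat) (f g : nat -> nat) : uniq r -> cancel f g ->
  (forall i, i \in r -> (2 <= f i)%N) ->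
  lspan (\bigcup_(i in [set i | i \in r]) calB R (f i)) =
    sum_spaces r (fun i => VgeoN R (f i)) /\
  has_dim (sum_spaces r (fun i => VgeoN R (f i))) (\sum_(i <- r) cardXi (f i))%N.
Proof.
move=> ur fK f2; split.
  rewrite (lspan_bigcup (fun i => calB R (f i)) ur).
  apply/seteqP; split=> v [w [Ww ->]]; exists w; split=> // i ir.
    by rewrite -(span_calB (f2 i ir)).1; exact: Ww.
  by rewrite (span_calB (f2 i ir)).1; exact: Ww.
apply: (@has_dim_sum R _ r (fun i => VgeoN R (f i)) (cardXi \o f)) => //.
  by move=> i ir; exact: (span_calB (f2 i ir)).2.
move=> w Ww w0 i ir.
have ufr : uniq (map f r) by rewrite map_inj_uniq //; exact: can_inj fK.
have fW j : j \in map f r -> VgeoN R j (w (g j)).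
  by move=> /mapP[k kr ->]; rewrite fK; exact: Ww.
have s0 : \sum_(j <- map f r) w (g j) = 0.
  by rewrite big_map -[RHS]w0; apply: eq_bigr => j _; rewrite fK.
have := sum_VgeoN_direct ufr fW s0 (map_f f ir).
by rewrite fK.
Qed.
End Dimension.

Theorem theorem3p12 (R : realType) :
  (forall N : nat, (2 <= N)%N ->
     lspan (calB R N) = VgeoN R N /\ has_dim (VgeoN R N) (cardXi N)) /\
  (forall delta : R, 0 < delta < 1 ->
     [/\ lspan (calBxi delta) = Vxi delta,
         has_dim (Vxi delta) (\sum_(2 <= i < (Nxi delta).+1) cardXi i)%N,
         lspan (calBxiG delta) = VxiG delta &
         has_dim (VxiG delta)
           (\sum_(1 <= i < (Nxi delta)./2.+1) cardXi (2 * i))%N]).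
Proof.
split=> [N|delta _]; first exact: span_calB.
have [||i|] := @span_calB_levels R (index_iota 2 (Nxi delta).+1) id id.
- exact: iota_uniq.
- by [].
- by rewrite mem_index_iota => /andP[].
have [||i|] := @span_calB_levels R (index_iota 1 (Nxi delta)./2.+1) (muln 2) half.
- exact: iota_uniq.
- by move=> i; rewrite mul2n doubleK.
- by rewrite mem_index_iota; lia.
have E (a b : nat) (B : nat -> set (pol R)) :
    \bigcup_(i in [set i | (a <= i <= b)%N]) B i =
    \bigcup_(i in [set i | i \in index_iota a b.+1]) B i.
  by congr bigcup; apply/seteqP; split=> i /=; rewrite mem_index_iota.
move=> spanG dimG span dim; split=> //.
- by rewrite /calBxi E.
- by rewrite /calBxiG E.
Qed.
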